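(* Let $q=e^{2\pi i/3}$ and let $A$ be the quantum plane with its first order differential calculus $(A^1,d)$, $\theta^1=\xi=dx$, $\theta^2=\eta=dy$, and bimodule automorphism $\sigma$ of $A^1\otimes_AA^1$ as described in the context. Let $\nabla^L$ be a left connection on $A^1$ with Christoffel symbols $\Gamma^i_{jk}\in A$, $\nabla^L\theta^i=\theta^j\otimes_A\theta^k\,\Gamma^i_{jk}$. Then the $\sigma$-compatibility condition $$\nabla^L\zeta=(\sigma\circ\nabla^R)\zeta\quad\text{for all }\zeta\in Z(A^1)$$ has a solution (i.e. is satisfied by some right connection $\nabla^R$ on $A^1$) if and only if $$\Gamma^1_{11}\in A,\quad \Gamma^1_{12}\in xA,\quad \Gamma^1_{21}\in xA,\quad \Gamma^1_{22}\in x^2A,\quad \Gamma^2_{11}\in A,\quad \Gamma^2_{22}\in xA,$$ $$(q-1)\Gamma^2_{12}+(1-q^2)\Gamma^2_{21}+3q^2yx^{-1}\Gamma^2_{22}\in xA.$$ Moreover, if these conditions hold, then the general solution is given by the right connection $\nabla^R$, $\nabla^R\theta^i=\theta^j\otimes_A\theta^k\,\widetilde\Gamma^i_{jk}$, with Christoffel symbols $$\widetilde\Gamma^1_{11}=q^2xy\Gamma^1_{11}y^{-1}x^{-1}+(1-q)y^2\Gamma^1_{12}y^{-1}x^{-1}+(q^2-1)y^2\Gamma^1_{21}y^{-1}x^{-1},$$ $$\widetilde\Gamma^1_{12}=(q^2-1)xy\Gamma^1_{12}y^{-1}x^{-1}+qxy\Gamma^1_{21}y^{-1}x^{-1}+(q-q^2)y^2\Gamma^1_{22}y^{-1}x^{-1},$$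 $$\widetilde\Gamma^1_{21}=qxy\Gamma^1_{12}y^{-1}x^{-1}+(1-q)y^2\Gamma^1_{22}y^{-1}x^{-1},$$ $$\widetilde\Gamma^1_{22}=q^2xy\Gamma^1_{22}y^{-1}x^{-1},$$ $$\begin{aligned}\widetilde\Gamma^2_{11}={}&xy\Gamma^1_{11}x^{-2}-x\Gamma^1_{11}yx^{-2}+(q-1)y\Gamma^1_{12}yx^{-2}+(q-q^2)y^2\Gamma^1_{12}x^{-2}\\&+(1-q^2)y\Gamma^1_{21}yx^{-2}+(1-q)y^2\Gamma^1_{21}x^{-2}+q^2x^2y^2\Gamma^2_{11}y^{-2}x^{-2}\\&+(q-1)x\Gamma^2_{12}yx^{-2}+(1-q^2)x\Gamma^2_{21}yx^{-2}+3y\Gamma^2_{22}yx^{-2},\end{aligned}$$ $$\begin{aligned}\widetilde\Gamma^2_{12}={}&(1-q^2)x\Gamma^1_{12}yx^{-2}+(q^2-1)y^2\Gamma^1_{22}x^{-2}+(1-q)xy\Gamma^1_{12}x^{-2}+q^2xy\Gamma^1_{21}x^{-2}\\&-qx\Gamma^1_{21}yx^{-2}+(q-1)y\Gamma^1_{22}yx^{-2}+(q^2-1)x^2y^2\Gamma^2_{12}y^{-2}x^{-2}\\&+qx^2y^2\Gamma^2_{21}y^{-2}x^{-2}+(q^2-q)x\Gamma^2_{22}yx^{-2},\end{aligned}$$ $$\begin{aligned}\widetilde\Gamma^2_{21}={}&q^2xy\Gamma^1_{12}x^{-2}-qx\Gamma^1_{12}yx^{-2}+(1-q^2)y\Gamma^1_{22}yx^{-2}+(q-q^2)y^2\Gamma^1_{22}x^{-2}\\&+qx^2y^2\Gamma^2_{12}y^{-2}x^{-2}+(q-1)x\Gamma^2_{22}yx^{-2},\end{aligned}$$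 $$\widetilde\Gamma^2_{22}=xy\Gamma^1_{22}x^{-2}-qx\Gamma^1_{22}yx^{-2}+q^2x^2y^2\Gamma^2_{22}y^{-2}x^{-2}.$$
   Context: Summation over repeated indices is understood, indices range over $\{1,2\}$. $A$ is the unital complex algebra generated by $x,y$ with the relation $xy=qyx$. The negative powers $x^{-1},y^{-1}$ are formal: $A$ is regarded as a subalgebra of its localization in which $x$ and $y$ are invertible (the algebra of Laurent polynomials in $x,y$ with $xy=qyx$), and the displayed formulas are equalities there; $x^{-1},y^{-1}$ are not elements of $A$, and the $\widetilde\Gamma^i_{jk}$ must belong to $A$. $A^1$ is the $A$-bimodule generated by $\xi=dx$ and $\eta=dy$ subject to $$x\xi=q^2\xi x,\quad x\eta=q\eta x+(q^2-1)\xi y,\quad y\xi=q\xi y,\quad y\eta=q^2\eta y;$$ it is free with basis $\{\xi,\eta\}$ both as a left and as a right $A$-module, and $d:A\to A^1$ is the derivation with $dx=\xi$, $dy=\eta$. The elements $\theta^i\otimes_A\theta^j$ form a basis of the right $A$-module $A^1\otimes_AA^1$. $\sigma:A^1\otimes_AA^1\to A^1\otimes_AA^1$ is the bimodule automorphism determined by $$\sigma(\xi\otimes_A\xi)=q^{-2}\xi\otimes_A\xi,\quad \sigma(\xi\otimes_A\eta)=q^{-1}\eta\otimes_A\xi,$$ $$\sigma(\eta\otimes_A\xi)=q^{-1}\xi\otimes_A\eta-(1-q^{-2})\eta\otimes_A\xi,\quad \sigma(\eta\otimes_A\eta)=q^{-2}\eta\otimes_A\eta.$$ A left connection on $A^1$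 is a linear map $\nabla^L:A^1\to A^1\otimes_AA^1$ with $\nabla^L(a\zeta)=da\otimes_A\zeta+a\nabla^L\zeta$; a right connection is a linear map $\nabla^R:A^1\to A^1\otimes_AA^1$ with $\nabla^R(\zeta a)=(\nabla^R\zeta)a+\zeta\otimes_Ada$ (for all $a\in A$, $\zeta\in A^1$). $Z(A^1)=\{\zeta\in A^1: a\zeta=\zeta a\ \ \forall a\in A\}$ is the centre of the bimodule $A^1$. *)

(* Defs.v *)
From HB Require Import structures.
From mathcomp Require Import all_boot all_order all_algebra.
From mathcomp Require Import complex.
From mathcomp Require Import reals trigo.

Set Implicit Arguments.
Unset Strict Implicit.
Unset Printing Implicit Defensive.

Import GRing.Theory.
Local Open Scope ring_scope.

Reserved Notation "u '*r' a" (at level 40, left associativity).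

Definition expi (R : realType) (t : R) : R[i] := Complex (cos t) (sin t).

Definition q3 (R : realType) : R[i] := expi (2 * pi / 3).

Definition alg_generated (C : fieldType) (A : algType C) (G : A -> Prop) : Prop :=
  forall S : A -> Prop,
    (forall a, G a -> S a) -> S 1 ->
    (forall (k : C) a b, S a -> S b -> S (k *: a + b)) ->
    (forall a b, S a -> S b -> S (a * b)) ->
    forall a, S a.

(* The algebra presented by the generators x, y and the relation xy = qyx. *)
Record quantum_plane (C : fieldType) (q : C) (A : algType C) (x y : A) : Prop := {
  qplane_rel : x * y = q *: (y * x);
  qplane_gen : alg_generated (fun a => a = x \/ a = y);
  qplane_univ : forall (B : algType C) (u v : B), u * v = q *: (v * u) ->
    exists f : {lrmorphism A -> B}, f x = u /\ f y = v }.

(* iota : A -> L exhibits L as the localization of A making x and y invertible,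
   and A as a subalgebra of L. *)
Record localization (C : fieldType) (A : algType C) (x y : A)
    (L : unitAlgType C) (iota : {lrmorphism A -> L}) : Prop := {
  loc_inj : injective iota;
  loc_unit_x : iota x \is a GRing.unit;
  loc_unit_y : iota y \is a GRing.unit;
  loc_gen : alg_generated (fun l =>
    (exists a, l = iota a) \/ l = (iota x)^-1 \/ l = (iota y)^-1);
  loc_univ : forall (B : unitAlgType C) (f : {lrmorphism A -> B}),
    f x \is a GRing.unit -> f y \is a GRing.unit ->
    exists g : {lrmorphism L -> B}, forall a, g (iota a) = f a }.

(* Bimodules over a C-algebra A: the left action is the one of lmodType, the two
   actions commute and induce the same action of the scalars of C. *)
HB.mixin Record Lmodule_isBimodule (C : fieldType) (A : algType C) M
    of GRing.Lmodule A M := {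
  ract : M -> A -> M;
  ractDl : forall (u v : M) (a : A), ract (u + v) a = ract u a + ract v a;
  ractDr : forall (u : M) (a b : A), ract u (a + b) = ract u a + ract u b;
  ract1 : forall u : M, ract u 1 = u;
  ractA : forall (u : M) (a b : A), ract (ract u a) b = ract u (a * b);
  lractA : forall (a : A) (u : M) (b : A), ract (a *: u) b = a *: ract u b;
  ract_scalar : forall (k : C) (u : M), ract u k%:A = k%:A *: u }.

#[short(type="bimodType")]
HB.structure Definition Bimodule (C : fieldType) (A : algType C) :=
  {M of Lmodule_isBimodule C A M & GRing.Lmodule A M}.

Notation "u *r a" := (ract u a) : ring_scope.

(* C-linearity; C acts on a bimodule through its image in A. *)
Definition Clinear (C : fieldType) (A : algType C) (M N : bimodType A)
    (f : M -> N) : Prop :=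
  forall (k : C) u v, f (k%:A *: u + v) = k%:A *: f u + f v.

Definition bimod_morphism (C : fieldType) (A : algType C) (M N : bimodType A)
    (f : M -> N) : Prop :=
  [/\ forall u v, f (u + v) = f u + f v,
      forall a u, f (a *: u) = a *: f u
    & forall u a, f (u *r a) = f u *r a].

Definition bimod_generated (C : fieldType) (A : algType C) (M : bimodType A)
    (G : M -> Prop) : Prop :=
  forall S : M -> Prop,
    (forall u, G u -> S u) -> S 0 ->
    (forall u v, S u -> S v -> S (u - v)) ->
    (forall a u, S u -> S (a *: u)) ->
    (forall u a, S u -> S (u *r a)) ->
    forall u, S u.

Definition left_basis2 (C : fieldType) (A : algType C) (M : bimodType A)
    (u v : M) : Prop :=
  forall m : M, exists! c : A * A, m = c.1 *: u + c.2 *: v.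

Definition right_basis2 (C : fieldType) (A : algType C) (M : bimodType A)
    (u v : M) : Prop :=
  forall m : M, exists! c : A * A, m = u *r c.1 + v *r c.2.

Definition bimod_center (C : fieldType) (A : algType C) (M : bimodType A)
    (u : M) : Prop :=
  forall a : A, a *: u = u *r a.

Definition form_relations (C : fieldType) (q : C) (A : algType C) (x y : A)
    (M : bimodType A) (xi eta : M) : Prop :=
  [/\ x *: xi = (q ^+ 2)%:A *: (xi *r x),
      x *: eta = q%:A *: (eta *r x) + (q ^+ 2 - 1)%:A *: (xi *r y),
      y *: xi = q%:A *: (xi *r y)
    & y *: eta = (q ^+ 2)%:A *: (eta *r y)].

(* The bimodule presented by the generators xi, eta and the relations above;
   it is free on {xi, eta} on both sides. *)
Record quantum_plane_forms (C : fieldType) (q : C) (A : algType C) (x y : A)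
    (M : bimodType A) (xi eta : M) : Prop := {
  forms_rel : form_relations q x y xi eta;
  forms_gen : bimod_generated (fun u => u = xi \/ u = eta);
  forms_univ : forall (N : bimodType A) (u v : N), form_relations q x y u v ->
    exists f : M -> N, [/\ bimod_morphism f, f xi = u & f eta = v];
  forms_left_free : left_basis2 xi eta;
  forms_right_free : right_basis2 xi eta }.

Definition derivation (C : fieldType) (A : algType C) (M : bimodType A)
    (d : A -> M) : Prop :=
  (forall (k : C) a b, d (k *: a + b) = k%:A *: d a + d b) /\
  (forall a b, d (a * b) = d a *r b + a *: d b).

Definition balanced (C : fieldType) (A : algType C) (M N : bimodType A)
    (G : zmodType) (f : M -> N -> G) : Prop :=
  [/\ forall m m' n, f (m + m') n = f m n + f m' n,
      forall m n n', f m (n + n') = f m n + f m n'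
    & forall m a n, f (m *r a) n = f m (a *: n)].

(* tens : M x N -> T exhibits T as the tensor product over A of M and N. *)
Record tensor_product (C : fieldType) (A : algType C) (M N T : bimodType A)
    (tens : M -> N -> T) : Prop := {
  tens_balanced : balanced tens;
  tens_left : forall a m n, tens (a *: m) n = a *: tens m n;
  tens_right : forall m n a, tens m (n *r a) = tens m n *r a;
  tens_gen : forall S : T -> Prop, (forall m n, S (tens m n)) -> S 0 ->
    (forall u v, S u -> S v -> S (u - v)) -> forall u, S u;
  tens_univ : forall (G : zmodType) (f : M -> N -> G), balanced f ->
    exists g : {additive T -> G}, forall m n, g (tens m n) = f m n }.

Definition braiding (C : fieldType) (q : C) (A : algType C) (M T : bimodType A)
    (tens : M -> M -> T) (xi eta : M) (sigma : T -> T) : Prop :=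
  [/\ bimod_morphism sigma, bijective sigma
    & [/\ sigma (tens xi xi) = (q ^- 2)%:A *: tens xi xi,
          sigma (tens xi eta) = (q^-1)%:A *: tens eta xi,
          sigma (tens eta xi) =
            (q^-1)%:A *: tens xi eta - (1 - q ^- 2)%:A *: tens eta xi
        & sigma (tens eta eta) = (q ^- 2)%:A *: tens eta eta]].

Definition left_connection (C : fieldType) (A : algType C) (M T : bimodType A)
    (tens : M -> M -> T) (d : A -> M) (nabla : M -> T) : Prop :=
  Clinear nabla /\
  forall (a : A) (z : M), nabla (a *: z) = tens (d a) z + a *: nabla z.

Definition right_connection (C : fieldType) (A : algType C) (M T : bimodType A)
    (tens : M -> M -> T) (d : A -> M) (nabla : M -> T) : Prop :=
  Clinear nabla /\
  forall (z : M) (a : A), nabla (z *r a) = nabla z *r a + tens z (d a).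

Definition sigma_compatible (C : fieldType) (A : algType C) (M T : bimodType A)
    (sigma : T -> T) (nablaL nablaR : M -> T) : Prop :=
  forall z : M, bimod_center z -> nablaL z = sigma (nablaR z).

(* The index set {1, 2} is 'I_2. *)
Definition i1 : 'I_2 := ord0.
Definition i2 : 'I_2 := ord_max.

Definition theta (M : Type) (xi eta : M) (i : 'I_2) : M :=
  if i == i1 then xi else eta.

(* G i j k is the symbol with upper index i and lower indices j, k. *)
Definition christoffel (C : fieldType) (A : algType C) (M T : bimodType A)
    (tens : M -> M -> T) (xi eta : M) (nabla : M -> T)
    (G : 'I_2 -> 'I_2 -> 'I_2 -> A) : Prop :=
  forall i : 'I_2, nabla (theta xi eta i) =
    \sum_(j < 2) \sum_(k < 2)
      tens (theta xi eta j) (theta xi eta k) *r G i j k.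

(* Membership of an element of L in the right ideal x^n A of the subalgebra A. *)
Definition in_xnA (C : fieldType) (A : algType C) (L : unitAlgType C)
    (iota : {lrmorphism A -> L}) (x : A) (n : nat) (l : L) : Prop :=
  exists a : A, l = iota (x ^+ n * a).

Definition solvability_conditions (C : fieldType) (q : C) (A : algType C)
    (L : unitAlgType C) (iota : {lrmorphism A -> L}) (x y : A)
    (G : 'I_2 -> 'I_2 -> 'I_2 -> A) : Prop :=
  let g i j k := iota (G i j k) in
  [/\ in_xnA iota x 0 (g i1 i1 i1),
      in_xnA iota x 1 (g i1 i1 i2),
      in_xnA iota x 1 (g i1 i2 i1)
    & in_xnA iota x 2 (g i1 i2 i2)] /\
  [/\ in_xnA iota x 0 (g i2 i1 i1),
      in_xnA iota x 1 (g i2 i2 i2)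
    & in_xnA iota x 1 ((q - 1) *: g i2 i1 i2 + (1 - q ^+ 2) *: g i2 i2 i1
        + (3 * q ^+ 2) *: (iota y * (iota x)^-1 * g i2 i2 i2))].

(* The symbols h of the right connection in terms of those g of the left one. *)
Definition solution_symbols (C : fieldType) (q : C) (L : unitAlgType C)
    (x y : L) (g h : 'I_2 -> 'I_2 -> 'I_2 -> L) : Prop :=
  [/\ h i1 i1 i1 =
        q ^+ 2 *: (x * y * g i1 i1 i1 * y^-1 * x^-1)
        + (1 - q) *: (y ^+ 2 * g i1 i1 i2 * y^-1 * x^-1)
        + (q ^+ 2 - 1) *: (y ^+ 2 * g i1 i2 i1 * y^-1 * x^-1),
      h i1 i1 i2 =
        (q ^+ 2 - 1) *: (x * y * g i1 i1 i2 * y^-1 * x^-1)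
        + q *: (x * y * g i1 i2 i1 * y^-1 * x^-1)
        + (q - q ^+ 2) *: (y ^+ 2 * g i1 i2 i2 * y^-1 * x^-1),
      h i1 i2 i1 =
        q *: (x * y * g i1 i1 i2 * y^-1 * x^-1)
        + (1 - q) *: (y ^+ 2 * g i1 i2 i2 * y^-1 * x^-1)
    & h i1 i2 i2 = q ^+ 2 *: (x * y * g i1 i2 i2 * y^-1 * x^-1)] /\
  [/\ h i2 i1 i1 =
        x * y * g i1 i1 i1 * x ^- 2
        - x * g i1 i1 i1 * y * x ^- 2
        + (q - 1) *: (y * g i1 i1 i2 * y * x ^- 2)
        + (q - q ^+ 2) *: (y ^+ 2 * g i1 i1 i2 * x ^- 2)
        + (1 - q ^+ 2) *: (y * g i1 i2 i1 * y * x ^- 2)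
        + (1 - q) *: (y ^+ 2 * g i1 i2 i1 * x ^- 2)
        + q ^+ 2 *: (x ^+ 2 * y ^+ 2 * g i2 i1 i1 * y ^- 2 * x ^- 2)
        + (q - 1) *: (x * g i2 i1 i2 * y * x ^- 2)
        + (1 - q ^+ 2) *: (x * g i2 i2 i1 * y * x ^- 2)
        + 3 *: (y * g i2 i2 i2 * y * x ^- 2),
      h i2 i1 i2 =
        (1 - q ^+ 2) *: (x * g i1 i1 i2 * y * x ^- 2)
        + (q ^+ 2 - 1) *: (y ^+ 2 * g i1 i2 i2 * x ^- 2)
        + (1 - q) *: (x * y * g i1 i1 i2 * x ^- 2)
        + q ^+ 2 *: (x * y * g i1 i2 i1 * x ^- 2)
        - q *: (x * g i1 i2 i1 * y * x ^- 2)
        + (q - 1) *: (y * g i1 i2 i2 * y * x ^- 2)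
        + (q ^+ 2 - 1) *: (x ^+ 2 * y ^+ 2 * g i2 i1 i2 * y ^- 2 * x ^- 2)
        + q *: (x ^+ 2 * y ^+ 2 * g i2 i2 i1 * y ^- 2 * x ^- 2)
        + (q ^+ 2 - q) *: (x * g i2 i2 i2 * y * x ^- 2),
      h i2 i2 i1 =
        q ^+ 2 *: (x * y * g i1 i1 i2 * x ^- 2)
        - q *: (x * g i1 i1 i2 * y * x ^- 2)
        + (1 - q ^+ 2) *: (y * g i1 i2 i2 * y * x ^- 2)
        + (q - q ^+ 2) *: (y ^+ 2 * g i1 i2 i2 * x ^- 2)
        + q *: (x ^+ 2 * y ^+ 2 * g i2 i1 i2 * y ^- 2 * x ^- 2)
        + (q - 1) *: (x * g i2 i2 i2 * y * x ^- 2)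
    & h i2 i2 i2 =
        x * y * g i1 i2 i2 * x ^- 2
        - q *: (x * g i1 i2 i2 * y * x ^- 2)
        + q ^+ 2 *: (x ^+ 2 * y ^+ 2 * g i2 i2 i2 * y ^- 2 * x ^- 2)].

(* Main.v *)
(* Since q is a primitive cube root of unity, x^3 and y^3 are central, commute with
   all forms and have zero differential. Sorting coefficients by their exponents
   modulo 3 shows that over C[x^3, y^3] the centre of A^1 is generated by
     xy xi = xi xy   and   x^2y^2 eta - xy^3 xi = eta x^2y^2 - q xi xy^3.
   Compatibility is therefore one equation for each of these two elements:
     sigma(nablaR xi) xy = xy nablaL xi,
     sigma(nablaR eta) x^2y^2 = x^2y^2 nablaL eta - x nablaL xi y^3 + q xy nablaL xi y^2.
   In the localization these equations determine the symbols of nablaR and give the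
   stated formulas. Whether the symbols lie in A is a question of divisibility by x,
   which is decided by the morphism eps : A -> C[y], x |-> 0, whose kernel is xA. *)

(* The symbols are arbitrary elements of [A] and need not commute with [x] or [y]. Each equation is
   therefore an identity between words in [x], [y] and unknown letters, with coefficients in Z[q],
   and is settled by a verified normal form computation. To stay within its reach, and because [eps]
   lives on [A] only, the formulas are used in [A] with their denominators multiplied out. The
   target of [eps] is commutative, so commutators [y * a - a * y] are invisible to it, and it
   detects only one factor [x] at a time. Membership in x^2A and the last solvability condition thus
   appear only after a factor [x] has been cancelled from the equations, and this cancellation
   relies on the divisibility found in the preceding round. The constants met on the way, such as
   [1 - q] and [q - q ^+ 2], are divisors of 3 = (1 - q)(1 - q^2); they are removed by completing
   them to 3, which is nonzero in the field. *)
Require Import Defs.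
From mathcomp Require Import all_boot all_order all_algebra.
From mathcomp Require Import boolp.
From mathcomp Require Import ring lra.
From mathcomp Require Import complex.
From mathcomp Require Import reals trigo.

Set Implicit Arguments.
Unset Strict Implicit.
Unset Printing Implicit Defensive.

Import Order.TTheory GRing.Theory Num.Theory.
Local Open Scope ring_scope.

(** * A decision procedure for noncommutative identities *)

Section Eisenstein.

(* [(a, b)] stands for [a + b * q], where [q ^+ 2 = - q - 1]. *)
Definition eis := (int * int)%type.

Definition eis_add (u v : eis) : eis := (u.1 + v.1, u.2 + v.2).
Definition eis_mul (u v : eis) : eis :=
  (u.1 * v.1 - u.2 * v.2, u.1 * v.2 + u.2 * v.1 - u.2 * v.2).
Definition eis_exp (u : eis) (n : nat) : eis := iter n (eis_mul u) (1, 0).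

Inductive sexpr :=
  | SQ | SNat of nat | SAdd of sexpr & sexpr | SOpp of sexpr
  | SMul of sexpr & sexpr | SExp of sexpr & nat.

Fixpoint snorm (e : sexpr) : eis :=
  match e with
  | SQ => (0, 1)
  | SNat n => (n%:Z, 0)
  | SAdd e f => eis_add (snorm e) (snorm f)
  | SOpp e => eis_mul (-1, 0) (snorm e)
  | SMul e f => eis_mul (snorm e) (snorm f)
  | SExp e n => eis_exp (snorm e) n
  end.

Variables (C : fieldType) (q : C).
Hypothesis q_rel : q ^+ 2 = - q - 1.

Definition eis_eval (u : eis) : C := u.1%:~R + u.2%:~R * q.

Lemma eis_evalD u v : eis_eval (eis_add u v) = eis_eval u + eis_eval v.
Proof. rewrite /eis_eval /= !intrD; ring. Qed.

Lemma eis_evalM u v : eis_eval (eis_mul u v) = eis_eval u * eis_eval v.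
Proof.
rewrite /eis_eval /= !intrD !rmorphN /= !intrM.
ring: q_rel.
Qed.

Lemma eis_evalX u n : eis_eval (eis_exp u n) = eis_eval u ^+ n.
Proof.
elim: n => [|n IH]; first by rewrite /eis_eval /= mul0r addr0 expr0.
by rewrite /eis_exp iterS eis_evalM exprS -IH.
Qed.

Fixpoint seval (e : sexpr) : C :=
  match e with
  | SQ => q
  | SNat n => n%:R
  | SAdd e f => seval e + seval f
  | SOpp e => - seval e
  | SMul e f => seval e * seval f
  | SExp e n => seval e ^+ n
  end.

Lemma snormP e : eis_eval (snorm e) = seval e.
Proof.
elim: e => /= [|n|e IHe f IHf|e IHe|e IHe f IHf|e IHe n].
- by rewrite /eis_eval /= add0r mul1r.
- by rewrite /eis_eval /= mul0r addr0 -pmulrn.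
- by rewrite eis_evalD IHe IHf.
- by rewrite eis_evalM IHe /eis_eval /= mul0r addr0 mulN1r.
- by rewrite eis_evalM IHe IHf.
- by rewrite eis_evalX IHe.
Qed.

End Eisenstein.

Section WordNormalForm.

(* Words are read with [0] for [x], [1] for [y] and [n.+2] for the [n]-th atom;
   normal forms are obtained from [x * y = q *: (y * x)] and from the fact that
   [y ^+ 3] is central. *)
Definition word := seq nat.

Fixpoint word_lmulx (w : word) : nat * word :=
  if w is 1%N :: w' then let r := word_lmulx w' in (r.1.+1, 1%N :: r.2)
  else (0%N, 0%N :: w).

Fixpoint word_lmul_atom (g : nat) (w : word) : word :=
  if w is [:: 1, 1, 1 & w']%N then [:: 1, 1, 1 & word_lmul_atom g w']%N
  else g :: w.

Definition word_lmul (l : nat) (w : word) : nat * word :=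
  match l with
  | 0%N => word_lmulx w
  | 1%N => (0%N, 1%N :: w)
  | _ => (0%N, word_lmul_atom l w)
  end.

Fixpoint word_mul (v w : word) : nat * word :=
  if v is l :: v' then
    let r := word_mul v' w in let s := word_lmul l r.2 in ((s.1 + r.1)%N, s.2)
  else (0%N, w).

Definition wpoly := seq (word * eis).

Fixpoint wpoly_add1 (w : word) (c : eis) (p : wpoly) : wpoly :=
  if p is (w', c') :: p' then
    if w == w' then (w', eis_add c c') :: p' else (w', c') :: wpoly_add1 w c p'
  else [:: (w, c)].

Definition wpoly_add (p r : wpoly) : wpoly :=
  foldr (fun m => wpoly_add1 m.1 m.2) r p.

Definition wpoly_scale (c : eis) (p : wpoly) : wpoly :=
  [seq (m.1, eis_mul c m.2) | m <- p].

Definition wpoly_lmul1 (m : word * eis) (p : wpoly) : wpoly :=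
  foldr (fun n => let r := word_mul m.1 n.1 in
    wpoly_add1 r.2 (eis_mul (eis_mul m.2 n.2) (eis_exp (0, 1) r.1))) [::] p.

Definition wpoly_mul (p r : wpoly) : wpoly :=
  foldr (fun m => wpoly_add (wpoly_lmul1 m r)) [::] p.

Inductive wexpr :=
  | WX | WY | WAtom of nat | W0 | W1 | WAdd of wexpr & wexpr | WOpp of wexpr
  | WMul of wexpr & wexpr | WExp of wexpr & nat | WScale of sexpr & wexpr.

Fixpoint wnorm (e : wexpr) : wpoly :=
  match e with
  | WX => [:: ([:: 0%N], (1, 0))]
  | WY => [:: ([:: 1%N], (1, 0))]
  | WAtom n => [:: ([:: n.+2], (1, 0))]
  | W0 => [::]
  | W1 => [:: ([::], (1, 0))]
  | WAdd e f => wpoly_add (wnorm e) (wnorm f)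
  | WOpp e => wpoly_scale (-1, 0) (wnorm e)
  | WMul e f => wpoly_mul (wnorm e) (wnorm f)
  | WExp e n => iter n (wpoly_mul (wnorm e)) [:: ([::], (1, 0))]
  | WScale s e => wpoly_scale (snorm s) (wnorm e)
  end.

(** Terms that cancel remain in the list with coefficient [(0, 0)], so the coefficients are
    inspected instead of asking for an empty list. *)
Definition wcheck (e f : wexpr) : bool :=
  all (fun m => m.2 == (0, 0)) (wnorm (WAdd e (WOpp f))).

Variables (C : fieldType) (q : C) (A : algType C) (x y : A).
Hypothesis q_rel : q ^+ 2 = - q - 1.
Hypothesis xy_rel : x * y = q *: (y * x).
Hypothesis y3_central : forall a, a * y ^+ 3 = y ^+ 3 * a.
Variable env : seq A.

Definition letter_eval (l : nat) : A :=
  match l with 0%N => x | 1%N => y | n.+2 => env`_n end.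

Definition word_eval (w : word) : A := foldr (fun l => *%R (letter_eval l)) 1 w.

Lemma word_lmulxP w :
  x * word_eval w = q ^+ (word_lmulx w).1 *: word_eval (word_lmulx w).2.
Proof.
elim: w => [|[|[|l]] w IH]; rewrite /= ?expr0 ?scale1r //.
by rewrite mulrA xy_rel -scalerAl -mulrA IH -scalerAr scalerA exprS.
Qed.

Lemma word_lmul_atomP g w :
  letter_eval g * word_eval w = word_eval (word_lmul_atom g w).
Proof.
(* The recursion strips three letters at a time, hence the induction on a bound for the size. *)
have [n] := ubnP (size w); elim: n w => // n IH [|[|[|k]] w] //.
case: w => [|[|[|k]] w] //; case: w => [|[|[|k]] w] //= lt_w.
rewrite -IH; last exact: ltnW (ltnW lt_w).
have y3E a : y * (y * (y * a)) = y ^+ 3 * a by rewrite !exprS expr0 mulr1 !mulrA.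
by rewrite !y3E mulrA y3_central mulrA.
Qed.

Lemma word_lmulP l w :
  letter_eval l * word_eval w = q ^+ (word_lmul l w).1 *: word_eval (word_lmul l w).2.
Proof.
case: l => [|[|l]]; first exact: word_lmulxP.
  by rewrite expr0 scale1r.
by rewrite word_lmul_atomP expr0 scale1r.
Qed.

Lemma word_mulP v w :
  word_eval v * word_eval w = q ^+ (word_mul v w).1 *: word_eval (word_mul v w).2.
Proof.
elim: v => [|l v IH] /=; first by rewrite mul1r expr0 scale1r.
by rewrite -mulrA IH -scalerAr word_lmulP scalerA -exprD addnC.
Qed.

Definition wpoly_eval (p : wpoly) : A :=
  foldr (fun m a => eis_eval q m.2 *: word_eval m.1 + a) 0 p.

Lemma wpoly_eval_add1 w c p :
  wpoly_eval (wpoly_add1 w c p) = eis_eval q c *: word_eval w + wpoly_eval p.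
Proof.
elim: p => [|[w' c'] p IH] //=; case: eqP => [->|_] /=.
  by rewrite eis_evalD scalerDl addrA.
by rewrite IH addrCA.
Qed.

Lemma wpoly_evalD p r : wpoly_eval (wpoly_add p r) = wpoly_eval p + wpoly_eval r.
Proof.
elim: p => [|m p IH] /=; first by rewrite add0r.
by rewrite wpoly_eval_add1 IH addrA.
Qed.

Lemma wpoly_evalZ c p : wpoly_eval (wpoly_scale c p) = eis_eval q c *: wpoly_eval p.
Proof.
elim: p => [|m p IH] /=; first by rewrite scaler0.
by rewrite IH eis_evalM // scalerDr scalerA.
Qed.

Lemma wpoly_eval_lmul1 m p :
  wpoly_eval (wpoly_lmul1 m p) = eis_eval q m.2 *: word_eval m.1 * wpoly_eval p.
Proof.
elim: p => [|n p IH] /=; first by rewrite mulr0.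
rewrite wpoly_eval_add1 IH mulrDr; congr (_ + _).
rewrite !eis_evalM // eis_evalX // -scalerAl -scalerAr word_mulP !scalerA.
by congr (_ * _ ^+ _ *: _); rewrite /eis_eval /= add0r mul1r.
Qed.

Lemma wpoly_evalM p r : wpoly_eval (wpoly_mul p r) = wpoly_eval p * wpoly_eval r.
Proof.
elim: p => [|m p IH] /=; first by rewrite mul0r.
by rewrite wpoly_evalD IH wpoly_eval_lmul1 mulrDl.
Qed.

Fixpoint weval (e : wexpr) : A :=
  match e with
  | WX => x
  | WY => y
  | WAtom n => env`_n
  | W0 => 0
  | W1 => 1
  | WAdd e f => weval e + weval f
  | WOpp e => - weval e
  | WMul e f => weval e * weval f
  | WExp e n => weval e ^+ n
  | WScale s e => seval q s *: weval e
  end.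

Lemma wnormP e : wpoly_eval (wnorm e) = weval e.
Proof.
have eis1 : eis_eval q (1, 0) = 1 by rewrite /eis_eval /= mul0r addr0.
elim: e => /= [||n|||e IHe f IHf|e IHe|e IHe f IHf|e IHe n|s e IHe];
  rewrite ?eis1 ?mulr1 ?scale1r ?addr0 //.
- by rewrite wpoly_evalD IHe IHf.
- by rewrite wpoly_evalZ IHe /eis_eval /= mul0r addr0 scaleN1r.
- by rewrite wpoly_evalM IHe IHf.
- elim: n => [|n IH] /=; first by rewrite eis1 scale1r addr0 expr0.
  by rewrite wpoly_evalM IH IHe exprS.
- by rewrite wpoly_evalZ snormP // IHe.
Qed.

Lemma wcheckP e f : wcheck e f -> weval e = weval f.
Proof.
rewrite /wcheck => h; apply: subr0_eq.
rewrite -[_ - _]/(weval (WAdd e (WOpp f))) -wnormP.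
have eis0 : eis_eval q (0, 0) = 0 by rewrite /eis_eval /= mul0r addr0.
by elim: (wnorm _) h => //= m p IH /andP[/eqP -> /IH ->]; rewrite eis0 scale0r addr0.
Qed.

End WordNormalForm.

Ltac reify_scalar q t :=
  lazymatch t with
  | q => constr:(SQ)
  | ?a + ?b =>
      let a' := reify_scalar q a in let b' := reify_scalar q b in
      constr:(SAdd a' b')
  | - ?a => let a' := reify_scalar q a in constr:(SOpp a')
  | ?a * ?b =>
      let a' := reify_scalar q a in let b' := reify_scalar q b in
      constr:(SMul a' b')
  | ?a ^+ ?n => let a' := reify_scalar q a in constr:(SExp a' n)
  | 0 => constr:(SNat 0)
  | 1 => constr:(SNat 1)
  | ?n%:R => constr:(SNat n)
  end.

Ltac atom_index a env :=
  lazymatch env with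
  | a :: _ => constr:(0%N)
  | _ :: ?env' => let n := atom_index a env' in constr:(n.+1)
  end.

Ltac add_atom a env :=
  lazymatch env with
  | context [a :: _] => env
  | _ => constr:(a :: env)
  end.

Ltac collect_atoms x y t env :=
  lazymatch t with
  | x => env
  | y => env
  | 0 => env
  | 1 => env
  | ?a + ?b => let env' := collect_atoms x y a env in collect_atoms x y b env'
  | - ?a => collect_atoms x y a env
  | ?a * ?b => let env' := collect_atoms x y a env in collect_atoms x y b env'
  | ?a ^+ _ => collect_atoms x y a env
  | _ *: ?a => collect_atoms x y a env
  | ?a => add_atom a env
  end.

Ltac reify_word q x y env t :=
  lazymatch t with
  | x => constr:(WX)
  | y => constr:(WY)
  | 0 => constr:(W0)
  | 1 => constr:(W1)
  | ?a + ?b =>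
      let a' := reify_word q x y env a in let b' := reify_word q x y env b in
      constr:(WAdd a' b')
  | - ?a => let a' := reify_word q x y env a in constr:(WOpp a')
  | ?a * ?b =>
      let a' := reify_word q x y env a in let b' := reify_word q x y env b in
      constr:(WMul a' b')
  | ?a ^+ ?n => let a' := reify_word q x y env a in constr:(WExp a' n)
  | ?c *: ?a =>
      let c' := reify_scalar q c in let a' := reify_word q x y env a in
      constr:(WScale c' a')
  | ?a => let n := atom_index a env in constr:(WAtom n)
  end.

(* Decides equality of noncommutative polynomials in [x], [y] and atoms, modulo
   [xy_rel], [q_rel] and the centrality of [y ^+ 3]; coefficients are integer
   polynomials in [q]. *)
Ltac qplane q_rel xy_rel y3_central :=
  lazymatch type of xy_rel with
  | ?x * ?y = ?q *: _ =>
    lazymatch goal with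
    | |- @eq ?T ?a ?b =>
      let env0 := constr:(@nil T) in
      let env1 := collect_atoms x y a env0 in
      let env := collect_atoms x y b env1 in
      let a' := reify_word q x y env a in
      let b' := reify_word q x y env b in
      refine (@wcheckP _ _ _ _ _ q_rel xy_rel y3_central env a' b' _);
      vm_compute; reflexivity
    end
  end.

(** * The quantum plane *)

Definition linear_pred (C : fieldType) (A : algType C) (P : A -> Prop) : Prop :=
  forall (k : C) a b, P a -> P b -> P (k *: a + b).

Lemma linear_pred0 (C : fieldType) (A : algType C) (P : A -> Prop) a :
  linear_pred P -> P a -> P 0.
Proof. by move=> lP Pa; have := lP (-1) _ _ Pa Pa; rewrite scaleN1r addNr. Qed.

Lemma linear_predZ (C : fieldType) (A : algType C) (P : A -> Prop) k a :
  linear_pred P -> P a -> P (k *: a).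
Proof.
by move=> lP Pa; have := lP k _ _ Pa (linear_pred0 lP Pa); rewrite addr0.
Qed.

(* [T] is injective and [S] acts on [b_k] as [q ^+ k *: T], so that an eigenvector
   for [q ^+ 2] has no component outside [b2]. *)
Lemma eigen_component (C : fieldType) (q : C) (A : algType C) (S T : A -> A)
    (b0 b1 b2 : A) :
  q ^+ 2 = - q - 1 -> 3 != 0 :> C ->
  (forall k a b, S (k *: a + b) = k *: S a + S b) ->
  (forall k a b, T (k *: a + b) = k *: T a + T b) ->
  injective T ->
  S b0 = T b0 -> S b1 = q *: T b1 -> S b2 = q ^+ 2 *: T b2 ->
  S (b0 + b1 + b2) = q ^+ 2 *: T (b0 + b1 + b2) -> b0 + b1 + b2 = b2.
Proof.
move=> q2 c3 linS linT injT S0 S1 S2 Sb.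
have addS a b : S (a + b) = S a + S b by rewrite -[a]scale1r linS !scale1r.
have addT a b : T (a + b) = T a + T b by rewrite -[a]scale1r linT !scale1r.
have T0 : T 0 = 0 by apply: (@addrI _ (T 0)); rewrite -addT !addr0.
have S0' : S 0 = 0 by apply: (@addrI _ (S 0)); rewrite -addS !addr0.
have scT k a : T (k *: a) = k *: T a by rewrite -[k *: a]addr0 linT T0 addr0.
have scS k a : S (k *: a) = k *: S a by rewrite -[k *: a]addr0 linS S0' addr0.
have E : (1 - q ^+ 2) *: b0 + (q - q ^+ 2) *: b1 = 0.
  apply: injT; rewrite T0 addT !scT !scalerBl scale1r.
  have := Sb; rewrite !addS !addT S0 S1 S2 !scalerDr => /addIr Sb'.
  by rewrite addrACA -opprD Sb' subrr.
(* Applying [S] to [E] puts an extra [q] on [b1] only; [q *: E] minus this relation is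
   [(1 - q) * (1 - q ^+ 2) *: b0 = 0], that is [3 *: b0 = 0]. *)
have E' : (1 - q ^+ 2) *: b0 + (q * (q - q ^+ 2)) *: b1 = 0.
  apply: injT; rewrite T0 addT !scT.
  have /(congr1 S) := E; rewrite S0' addS !scS S0 S1 scalerA => <-.
  by rewrite [_ * q]mulrC.
have b00 : b0 = 0.
  have : (3 : C) *: b0 = 0.
    have -> : 3 = (1 - q) * (1 - q ^+ 2) by ring: q2.
    move/eqP: E'; rewrite addrC.
    rewrite addr_eq0 => /eqP E1.
    have := congr1 (fun a => q *: a) E; rewrite scalerDr !scalerA E1 scaler0.
    move=> /eqP; rewrite subr_eq0 => /eqP E2.
    by rewrite mulrBl mul1r scalerBl E2 subrr.
  by move/eqP; rewrite scaler_eq0 (negPf c3) => /eqP.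
move: E; rewrite b00 scaler0 !add0r => /(congr1 (fun a => - (q - q ^+ 2) *: a)).
rewrite scaler0 scalerA.
have -> : - (q - q ^+ 2) * (q - q ^+ 2) = 3 by ring: q2.
by move/eqP; rewrite scaler_eq0 (negPf c3) => /eqP ->; rewrite add0r.
Qed.

Section QuantumPlane.

Variables (C : fieldType) (q : C) (A : algType C) (x y : A).
Hypotheses (q_rel : q ^+ 2 = - q - 1) (three_neq0 : 3 != 0 :> C).
Hypothesis hA : quantum_plane q x y.
Variables (L : unitAlgType C) (iota : {lrmorphism A -> L}).
Hypothesis hL : localization x y iota.

Let xy_rel : x * y = q *: (y * x) := qplane_rel hA.

Lemma q3_eq1 : q ^+ 3 = 1.
Proof. by ring: q_rel. Qed.

Lemma mul_xXy k : x * y ^+ k = q ^+ k *: (y ^+ k * x).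
Proof.
elim: k => [|k IH]; first by rewrite !expr0 mulr1 mul1r scale1r.
by rewrite !exprS mulrA xy_rel -scalerAl -[y * x * _]mulrA IH -scalerAr scalerA mulrA.
Qed.

Lemma mul_Xxy l : x ^+ l * y = q ^+ l *: (y * x ^+ l).
Proof.
elim: l => [|l IH]; first by rewrite !expr0 mulr1 mul1r scale1r.
rewrite !exprSr -[x ^+ l * x * y]mulrA xy_rel -scalerAr [x ^+ l * (_ * _)]mulrA IH.
by rewrite -scalerAl scalerA -mulrA [q * _]mulrC.
Qed.

(** The ordered monomials span [A]. Here [mono] is their span, encoded impredicatively; it is stable
    under left multiplication by the generators, hence by all of [A], and contains 1. *)
Lemma monomial_ind (P : A -> Prop) :
  linear_pred P -> (forall k l, P (y ^+ k * x ^+ l)) -> forall a, P a.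
Proof.
pose mono a := forall P, linear_pred P -> (forall k l, P (y ^+ k * x ^+ l)) -> P a.
suff mul_mono a b : mono b -> mono (a * b).
  move=> lP Pm a; rewrite -[a]mulr1; apply: mul_mono lP Pm => P' _ /(_ 0%N 0%N).
  by rewrite !expr0 mulr1.
move: a b; apply: (qplane_gen hA (S := fun a => forall b, mono b -> mono (a * b))).
- move=> _ [] -> b mb P' lP Pm.
    apply: (mb (fun b => P' (x * b))) => [k a c Pa Pc|k l].
      by rewrite mulrDr -scalerAr; apply: lP.
    by rewrite mulrA mul_xXy -scalerAl -mulrA -exprS; apply: linear_predZ.
  apply: (mb (fun b => P' (y * b))) => [k a c Pa Pc|k l].
    by rewrite mulrDr -scalerAr; apply: lP.
  by rewrite mulrA -exprS.
- by move=> b; rewrite mul1r.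
- move=> k a c ma mc b mb P' lP Pm; rewrite mulrDl -scalerAl.
  by apply: (lP); [apply: ma | apply: mc].
- by move=> a c ma mc b mb; rewrite -mulrA; apply: ma; apply: mc.
Qed.

Lemma commute_gen c : c * x = x * c -> c * y = y * c -> forall a, c * a = a * c.
Proof.
move=> cx cy; apply: (qplane_gen hA).
- by move=> a [] ->.
- by rewrite mul1r mulr1.
- by move=> k a b ca cb; rewrite mulrDr mulrDl -scalerAr -scalerAl ca cb.
- by move=> a b ca cb; rewrite mulrA ca -mulrA cb mulrA.
Qed.

Lemma x3_central a : a * x ^+ 3 = x ^+ 3 * a.
Proof.
apply/esym; apply: (commute_gen) a; first by rewrite -exprSr -exprS.
by rewrite mul_Xxy q3_eq1 scale1r.
Qed.

Lemma y3_central a : a * y ^+ 3 = y ^+ 3 * a.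
Proof.
apply/esym; apply: (commute_gen) a; last by rewrite -exprSr -exprS.
by rewrite mul_xXy q3_eq1 scale1r.
Qed.

Lemma q_neq0 : q != 0.
Proof. by apply: contraNneq (oner_neq0 C) => q0; rewrite -q3_eq1 q0 expr0n. Qed.

Lemma mulx_swapl a : exists b, x * a = b * x.
Proof.
apply: (monomial_ind (P := fun a => exists b, x * a = b * x)) a.
  move=> k a' c' [b eb] [c ec]; exists (k *: b + c).
  by rewrite mulrDr mulrDl -scalerAr -scalerAl eb ec.
move=> k l; exists (q ^+ k *: (y ^+ k * x ^+ l)).
by rewrite mulrA mul_xXy -!scalerAl -!mulrA -exprS -exprSr.
Qed.

Lemma mulx_swapr a : exists b, a * x = x * b.
Proof.
apply: (monomial_ind (P := fun a => exists b, a * x = x * b)) a.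
  move=> k a' c' [b eb] [c ec]; exists (k *: b + c).
  by rewrite mulrDr mulrDl -scalerAr -scalerAl eb ec.
move=> k l; exists (q ^- k *: (y ^+ k * x ^+ l)).
rewrite -scalerAr mulrA mul_xXy -scalerAl scalerA mulVf ?expf_neq0 ?q_neq0 //.
by rewrite scale1r -!mulrA -exprS -exprSr.
Qed.

Lemma muly_swapl a : exists b, y * a = b * y.
Proof.
apply: (monomial_ind (P := fun a => exists b, y * a = b * y)) a.
  move=> k a' c' [b eb] [c ec]; exists (k *: b + c).
  by rewrite mulrDr mulrDl -scalerAr -scalerAl eb ec.
move=> k l; exists (q ^- l *: (y ^+ k * x ^+ l)).
rewrite -scalerAl -mulrA mul_Xxy -scalerAr scalerA mulVf ?expf_neq0 ?q_neq0 //.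
by rewrite scale1r !mulrA -exprS -exprSr.
Qed.

Lemma x_lreg : injective ( *%R x).
Proof.
move=> a b /(congr1 iota); rewrite !rmorphM => /(mulrI (loc_unit_x hL)).
exact: (loc_inj hL).
Qed.

Lemma x_rreg : injective ( *%R^~ x).
Proof.
move=> a b /(congr1 iota); rewrite !rmorphM => /(mulIr (loc_unit_x hL)).
exact: (loc_inj hL).
Qed.

Lemma y_lreg : injective ( *%R y).
Proof.
move=> a b /(congr1 iota); rewrite !rmorphM => /(mulrI (loc_unit_y hL)).
exact: (loc_inj hL).
Qed.

(** Evaluation at [y] is a section of [eps], and every [a] agrees with the section of its image
    modulo [x * A]; a vanishing image therefore leaves a multiple of [x]. *)
Lemma eval_x0 : exists eps : {lrmorphism A -> {poly C}},
  [/\ eps x = 0, eps y = 'X & forall a, eps a = 0 -> exists b, a = x * b].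
Proof.
have [|eps [ex ey]] := qplane_univ hA (u := 0 : {poly C}) (v := 'X).
  by rewrite mul0r mulr0 scaler0.
exists eps; split=> // a ea.
have [b] : exists b, a = horner_alg y (eps a) + x * b; last first.
  by rewrite ea rmorph0 add0r; exists b.
move: a {ea}.
apply: (monomial_ind (P := fun a => exists b, a = horner_alg y (eps a) + x * b)).
  move=> k a' c' [b eb] [c ec]; exists (k *: b + c).
  rewrite linearP -mul_polyC rmorphD rmorphM /= horner_algC mulr_algl.
  by rewrite [in LHS]eb [in LHS]ec mulrDr -scalerAr scalerDr addrACA.
move=> k [|l].
  exists 0; rewrite mulr0 addr0 expr0 mulr1 rmorphXn /= ey rmorphXn /=.
  by rewrite horner_algX.
have [b eb] := mulx_swapr (y ^+ k * x ^+ l).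
have exb : eps (x * b) = 0 by rewrite rmorphM /= ex mul0r.
by exists b; rewrite exprSr mulrA eb exb rmorph0 add0r.
Qed.

(** Euclidean division of both exponents by 3. The coefficients [Z] are abstract because they will
    be taken to be the elements that are constant for the calculus, which include all polynomials in
    x^3 and y^3. *)
Lemma monomial_mod3 (Z : A -> Prop) : linear_pred Z ->
    (forall k l, Z (y ^+ (3 * k) * x ^+ (3 * l))) ->
  forall a, exists f : nat -> nat -> A, (forall i j, Z (f i j)) /\
    a = \sum_(i < 3) \sum_(j < 3) y ^+ i * x ^+ j * f i j.
Proof.
move=> lZ Zm.
apply: monomial_ind.
  move=> k _ _ [f [Zf ->]] [g [Zg ->]]; exists (fun i j => k *: f i j + g i j).
  split=> [i j|]; first exact: lZ.
  rewrite scaler_sumr -big_split /=; apply: eq_bigr => i _.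
  rewrite scaler_sumr -big_split /=; apply: eq_bigr => j _.
  by rewrite mulrDr -scalerAr.
move=> k l.
pose z := y ^+ (3 * (k %/ 3)) * x ^+ (3 * (l %/ 3)).
have Zz : Z z by apply: Zm.
have Z0 : Z 0 := linear_pred0 lZ Zz.
exists (fun i j => if (i == k %% 3)%N && (j == l %% 3)%N then z else 0).
split=> [i j|]; first by case: ifP.
have lt3 n : (n %% 3 < 3)%N by rewrite ltn_mod.
rewrite (bigD1 (Ordinal (lt3 k))) //= (bigD1 (Ordinal (lt3 l))) //= !eqxx /=.
rewrite big1 => [|j /negPf]; last first.
  by rewrite -val_eqE /= => ->; rewrite mulr0.
rewrite big1 => [|i /negPf]; last first.
  by rewrite -val_eqE /= => ->; apply: big1 => j _; rewrite mulr0.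
have expE (t : A) n : t ^+ n = t ^+ (n %% 3)%N * t ^+ (3 * (n %/ 3)).
  by rewrite -exprD addnC mulnC -divn_eq.
have comm_y3 n b : b * y ^+ (3 * n) = y ^+ (3 * n) * b.
  rewrite exprM; elim: n => [|n IH]; first by rewrite mulr1 mul1r.
  by rewrite exprS mulrA y3_central -!mulrA IH.
rewrite !addr0 /z (expE y k) (expE x l) -!mulrA; congr (_ * _).
by rewrite mulrA -comm_y3 -mulrA.
Qed.

(* The eigenvalue conditions single out the monomials whose two exponents are
   both congruent to 2 modulo 3. *)
Lemma eigen_y2x2 (Z : A -> Prop) b : linear_pred Z ->
    (forall k l, Z (y ^+ (3 * k) * x ^+ (3 * l))) ->
    (forall z, Z z -> forall a, z * a = a * z) ->
    x * b = q ^+ 2 *: (b * x) -> b * y = q ^+ 2 *: (y * b) ->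
  exists2 z, Z z & b = y ^+ 2 * x ^+ 2 * z.
Proof.
move=> lZ Zm Zc xb yb.
have [f [Zf eb]] := monomial_mod3 lZ Zm b.
have sum3 (g : nat -> A) : \sum_(i < 3) g i = g 0%N + g 1%N + g 2%N.
  by rewrite 3!big_ord_recr big_ord0 /= add0r.
(* Grouped by the exponent of [y], the pieces are eigenvectors for conjugation by [x]; the pieces of
   [r 2], sorted by the exponent of [x], are then eigenvectors for conjugation by [y]. *)
pose r i := \sum_(j < 3) y ^+ i * x ^+ j * f i j.
have xr i : x * r i = q ^+ i *: (r i * x).
  rewrite mulr_sumr mulr_suml scaler_sumr; apply: eq_bigr => j _.
  rewrite -[in RHS]mulrA (Zc _ (Zf _ _)) !mulrA mul_xXy -!scalerAl; congr (_ *: _).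
  by rewrite -[y ^+ i * x * _]mulrA -[y ^+ i * _ * x]mulrA -exprS -exprSr.
have eb2 : b = r 2%N.
  have linl k a c : x * (k *: a + c) = k *: (x * a) + x * c.
    by rewrite mulrDr scalerAr.
  have linr k a c : (k *: a + c) * x = k *: (a * x) + c * x.
    by rewrite mulrDl scalerAl.
  have := eigen_component (S := *%R x) (T := *%R^~ x) q_rel three_neq0 linl linr
    x_rreg (b0 := r 0%N) (b1 := r 1%N) (b2 := r 2%N).
  have -> : r 0%N + r 1%N + r 2%N = b.
    by rewrite eb (sum3 r).
  by apply; rewrite /= ?xr ?expr0 ?scale1r ?expr1.
pose s j := y ^+ 2 * x ^+ j * f 2%N j.
have ys j : s j * y = q ^+ j *: (y * s j).
  rewrite /s -mulrA (Zc _ (Zf _ _)) !mulrA -[_ * _ * y]mulrA mul_Xxy.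
  by rewrite -scalerAr -scalerAl !expr2 !mulrA.
exists (f 2%N 2%N) => //.
have linl k a c : y * (k *: a + c) = k *: (y * a) + y * c.
  by rewrite mulrDr scalerAr.
have linr k a c : (k *: a + c) * y = k *: (a * y) + c * y.
  by rewrite mulrDl scalerAl.
have := eigen_component (S := *%R^~ y) (T := *%R y) q_rel three_neq0 linr linl
  y_lreg (b0 := s 0%N) (b1 := s 1%N) (b2 := s 2%N).
have -> : s 0%N + s 1%N + s 2%N = b by rewrite eb2 /r (sum3 s).
by apply; rewrite /= ?ys ?expr0 ?scale1r ?expr1.
Qed.

End QuantumPlane.

(** * Divisibility and solvability *)

(* [solution_symbols] with the denominators [x * y] and [x ^+ 2 * y ^+ 2]
   cleared on the right, so that it makes sense in the quantum plane itself. *)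
Definition cleared_symbols (C : fieldType) (q : C) (A : algType C)
    (x y : A) (g h : 'I_2 -> 'I_2 -> 'I_2 -> A) : Prop :=
  [/\ h i1 i1 i1 * (x * y) =
        q ^+ 2 *: (x * y * g i1 i1 i1) + (1 - q) *: (y ^+ 2 * g i1 i1 i2)
        + (q ^+ 2 - 1) *: (y ^+ 2 * g i1 i2 i1),
      h i1 i1 i2 * (x * y) =
        (q ^+ 2 - 1) *: (x * y * g i1 i1 i2) + q *: (x * y * g i1 i2 i1)
        + (q - q ^+ 2) *: (y ^+ 2 * g i1 i2 i2),
      h i1 i2 i1 * (x * y) =
        q *: (x * y * g i1 i1 i2) + (1 - q) *: (y ^+ 2 * g i1 i2 i2)
    & h i1 i2 i2 * (x * y) = q ^+ 2 *: (x * y * g i1 i2 i2)] /\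
  [/\ h i2 i1 i1 * (x ^+ 2 * y ^+ 2) =
        x * y * g i1 i1 i1 * y ^+ 2
        - x * g i1 i1 i1 * y * y ^+ 2
        + (q - 1) *: (y * g i1 i1 i2 * y * y ^+ 2)
        + (q - q ^+ 2) *: (y ^+ 2 * g i1 i1 i2 * y ^+ 2)
        + (1 - q ^+ 2) *: (y * g i1 i2 i1 * y * y ^+ 2)
        + (1 - q) *: (y ^+ 2 * g i1 i2 i1 * y ^+ 2)
        + q ^+ 2 *: (x ^+ 2 * y ^+ 2 * g i2 i1 i1)
        + (q - 1) *: (x * g i2 i1 i2 * y * y ^+ 2)
        + (1 - q ^+ 2) *: (x * g i2 i2 i1 * y * y ^+ 2)
        + 3 *: (y * g i2 i2 i2 * y * y ^+ 2),
      h i2 i1 i2 * (x ^+ 2 * y ^+ 2) =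
        (1 - q ^+ 2) *: (x * g i1 i1 i2 * y * y ^+ 2)
        + (q ^+ 2 - 1) *: (y ^+ 2 * g i1 i2 i2 * y ^+ 2)
        + (1 - q) *: (x * y * g i1 i1 i2 * y ^+ 2)
        + q ^+ 2 *: (x * y * g i1 i2 i1 * y ^+ 2)
        - q *: (x * g i1 i2 i1 * y * y ^+ 2)
        + (q - 1) *: (y * g i1 i2 i2 * y * y ^+ 2)
        + (q ^+ 2 - 1) *: (x ^+ 2 * y ^+ 2 * g i2 i1 i2)
        + q *: (x ^+ 2 * y ^+ 2 * g i2 i2 i1)
        + (q ^+ 2 - q) *: (x * g i2 i2 i2 * y * y ^+ 2),
      h i2 i2 i1 * (x ^+ 2 * y ^+ 2) =
        q ^+ 2 *: (x * y * g i1 i1 i2 * y ^+ 2)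
        - q *: (x * g i1 i1 i2 * y * y ^+ 2)
        + (1 - q ^+ 2) *: (y * g i1 i2 i2 * y * y ^+ 2)
        + (q - q ^+ 2) *: (y ^+ 2 * g i1 i2 i2 * y ^+ 2)
        + q *: (x ^+ 2 * y ^+ 2 * g i2 i1 i2)
        + (q - 1) *: (x * g i2 i2 i2 * y * y ^+ 2)
    & h i2 i2 i2 * (x ^+ 2 * y ^+ 2) =
        x * y * g i1 i2 i2 * y ^+ 2
        - q *: (x * g i1 i2 i2 * y * y ^+ 2)
        + q ^+ 2 *: (x ^+ 2 * y ^+ 2 * g i2 i2 i2)].

Section Solvability.

Variables (C : fieldType) (q : C) (A : algType C) (x y : A).
Hypotheses (q_rel : q ^+ 2 = - q - 1) (three_neq0 : 3 != 0 :> C).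
Hypothesis hA : quantum_plane q x y.
Variables (L : unitAlgType C) (iota : {lrmorphism A -> L}).
Hypothesis hL : localization x y iota.

Let xy_rel : x * y = q *: (y * x) := qplane_rel hA.
Let y3c : forall a, a * y ^+ 3 = y ^+ 3 * a := y3_central q_rel hA.

(** Every left-hand side contains [x] and dies under [eps], so each equation becomes a linear
    relation over C[y] between the images of the symbols of the left connection. *)
Lemma cleared_symbols_solvable g h :
  cleared_symbols q x y g h -> solvability_conditions q iota x y g.
Proof.
have [eps [ex ey ker_eps]] := eval_x0 q_rel hA.
have eps_mulx a : eps (x * a) = 0 by rewrite rmorphM /= ex mul0r.
have epsZ k a : eps (k *: a) = k%:P * eps a by rewrite linearZ /= mul_polyC.
have epsD a b : eps (a + b) = eps a + eps b := rmorphD eps a b.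
have epsN a : eps (- a) = - eps a := rmorphN eps a.
have epsM a b : eps (a * b) = eps a * eps b := rmorphM eps a b.
have epsX a n : eps (a ^+ n) = eps a ^+ n := rmorphXn eps n a.
have polyCD a b : (a + b)%:P = a%:P + b%:P := rmorphD (@polyC C) a b.
have polyCM a b : (a * b)%:P = a%:P * b%:P := rmorphM (@polyC C) a b.
have polyCN (a : C) : (- a)%:P = - a%:P := rmorphN (@polyC C) a.
pose w : {poly C} := q%:P.
have w_rel : w ^+ 2 = - w - 1 by rewrite -rmorphXn q_rel rmorphB rmorphN rmorph1.
have wXn n : (q ^+ n)%:P = w ^+ n by rewrite rmorphXn.
have three_poly : (3 : C)%:P = 3 :> {poly C} by rewrite rmorph_nat.
pose epsE := (epsZ, epsD, epsN, epsX, epsM, ex, ey, wXn, polyCD, polyCN, polyCM,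
  polyC1, three_poly).
have cancel3X n (p : {poly C}) : 3 * 'X^n * p = 0 -> p = 0.
  move/eqP; rewrite mulf_eq0 -three_poly mulf_eq0 polyC_eq0 (negPf three_neq0).
  by rewrite expf_eq0 polyX_eq0 andbF /= => /eqP.
case=> [[H111 H112 _ _] [H211 H212 H221 _]].
move: (h i1 i1 i1) (h i1 i1 i2) (h i2 i1 i1) (h i2 i1 i2) (h i2 i2 i1)
  H111 H112 H211 H212 H221 => h111 h112 h211 h212 h221 H111 H112 H211 H212 H221.
rewrite /solvability_conditions /in_xnA.
move: (g i1 i1 i1) (g i1 i1 i2) (g i1 i2 i1) (g i1 i2 i2)
  (g i2 i1 i1) (g i2 i1 i2) (g i2 i2 i1) (g i2 i2 i2) H111 H112 H211 H212 H221 =>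
  g111 g112 g121 g122 g211 g212 g221 g222 H111 H112 H211 H212 H221.
have [e1 g122E] : exists e1, g122 = x * e1.
  apply/ker_eps/(cancel3X 2%N); have := congr1 eps H112.
  rewrite !epsE -/w => E.
  have -> : 3 * 'X^2 * eps g122 = (w ^+ 2 - w) * ((w - w ^+ 2) * ('X^2 * eps g122)).
    by ring: w_rel.
  by move: E; rewrite !(mul0r, mulr0, add0r) => <-; rewrite mulr0.
(* Now that [g122] is a multiple of [x], every term on the right of [H212] and [H221] is one too.
   Bringing an [x] to the front on the left as well allows one factor to be cancelled before [eps]
   is applied. *)
have [h212' h212E] := mulx_swapr q_rel hA h212.
have [h221' h221E] := mulx_swapr q_rel hA h221.
have E111 := congr1 eps H111.
have E211 := congr1 eps H211.
have E221 : h221' * (x * y ^+ 2) = (q ^+ 2 *: (y * g112) - q *: (g112 * y)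
    + ((1 - q ^+ 2) * q ^+ 2) *: (y * e1 * y) + ((q - q ^+ 2) * q) *: (y ^+ 2 * e1)
    + (q - 1) *: (g222 * y)) * y ^+ 2 + q *: (x * y ^+ 2 * g212).
  apply: (x_lreg hL); rewrite mulrA -h221E -mulrA [x * _ in LHS]mulrA -expr2 H221 g122E.
  by qplane q_rel xy_rel y3c.
have E212 : h212' * (x * y ^+ 2) = ((1 - q ^+ 2) *: (g112 * y)
    + ((q ^+ 2 - 1) * q) *: (y ^+ 2 * e1) + (1 - q) *: (y * g112)
    + q ^+ 2 *: (y * g121) - q *: (g121 * y) + ((q - 1) * q ^+ 2) *: (y * e1 * y)
    + (q ^+ 2 - q) *: (g222 * y)) * y ^+ 2
    + x * ((q ^+ 2 - 1) *: (y ^+ 2 * g212) + q *: (y ^+ 2 * g221)).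
  apply: (x_lreg hL); rewrite mulrA -h212E -mulrA [x * _ in LHS]mulrA -expr2 H212 g122E.
  by qplane q_rel xy_rel y3c.
move/(congr1 eps): E221; move/(congr1 eps): E212; move: E111 E211.
rewrite !epsE -/w.
move=> E111 E211 E212 E221.
have F111 : (1 - w) * ('X^2 * eps g112) + (w ^+ 2 - 1) * ('X^2 * eps g121) = 0.
  by move/eqP: E111; rewrite eq_sym -subr_eq0 => /eqP <-; ring.
have F211 : 3 * 'X^4 * (w * eps g112 + eps g121 + eps g222) = 0.
  by move/eqP: E211; rewrite eq_sym -subr_eq0 => /eqP <-; ring: w_rel.
have F221 : 'X^3 * ((w ^+ 2 - w) * eps g112 + 3 * w ^+ 2 * 'X * eps e1
    + (w - 1) * eps g222) = 0.
  by move/eqP: E221; rewrite eq_sym -subr_eq0 => /eqP <-; ring: w_rel.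
have F212 : 'X^3 * (3 * eps g112 + (w ^+ 2 - w) * (eps g121 + eps g222)
    + 3 * 'X * eps e1) = 0.
  by move/eqP: E212; rewrite eq_sym -subr_eq0 => /eqP <-; ring: w_rel.
have G111 : eps g112 + w ^+ 2 * eps g121 = 0.
  apply: (cancel3X 2%N); rewrite -(mulr0 (1 - w ^+ 2)) -F111; ring: w_rel.
have G211 : w * eps g112 + eps g121 + eps g222 = 0 by apply: cancel3X F211.
have e222 : eps g222 = 0.
  by rewrite -[RHS]G211 -[LHS]addr0 -(mulr0 w) -G111; ring: w_rel.
have e112 : eps g112 = 0.
  apply: (cancel3X 3%N).
  (* In [w ^+ 2] times [F212] minus [F221] the terms in [e1] and [g222] cancel; [G111] then removes
     [g121], leaving [(w - 1) * eps g112], and [w ^+ 2 - 1] turns the factor into 3. *)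
  transitivity ((w ^+ 2 - 1) * (w ^+ 2 * ('X^3 * (3 * eps g112 + (w ^+ 2 - w)
    * (eps g121 + eps g222) + 3 * 'X * eps e1)) - 'X^3 * ((w ^+ 2 - w) * eps g112
    + 3 * w ^+ 2 * 'X * eps e1 + (w - 1) * eps g222)
    - (w - 1) * w * 'X^3 * (eps g112 + w ^+ 2 * eps g121))).
    by ring: w_rel.
  by rewrite F212 F221 G111 !(mulr0, subr0).
have e121 : eps g121 = 0.
  by move: G211; rewrite e112 e222 mulr0 add0r addr0.
have ee1 : eps e1 = 0.
  by apply: (cancel3X 4%N); rewrite -F212 e112 e121 e222; ring.
have [b1 g112E] := ker_eps _ e112.
have [c1 g121E] := ker_eps _ e121.
have [e2 e1E] := ker_eps _ ee1.
have [u g222E] := ker_eps _ e222.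
have [h211' h211E] := mulx_swapr q_rel hA h211.
(* Once an [x] has been cancelled from [H211], the [g111], [b1] and [c1] terms have images that
   cancel in the commutative ring C[y], so only the combination of the last condition survives. *)
have [v Sv] : exists v, (q - 1) *: g212 + (1 - q ^+ 2) *: g221 + (3 * q ^+ 2) *: (y * u)
    = x * v.
  apply/ker_eps/(cancel3X 3%N).
  have : h211' * (x * y ^+ 2) = (y * g111 - g111 * y + ((q - 1) * q ^+ 2) *: (y * b1 * y)
      + ((q - q ^+ 2) * q) *: (y ^+ 2 * b1) + ((1 - q ^+ 2) * q ^+ 2) *: (y * c1 * y)
      + ((1 - q) * q) *: (y ^+ 2 * c1) + ((q - 1) *: g212 + (1 - q ^+ 2) *: g221
      + (3 * q ^+ 2) *: (y * u)) * y) * y ^+ 2 + q ^+ 2 *: (x * y ^+ 2 * g211).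
    apply: (x_lreg hL); rewrite mulrA -h211E -mulrA [x * _ in LHS]mulrA -expr2 H211.
    rewrite g112E g121E g222E.
    by qplane q_rel xy_rel y3c.
  move/(congr1 eps); rewrite !epsE -/w => /eqP; rewrite eq_sym -subr_eq0 => /eqP E.
  by rewrite -[RHS](mulr0 3) -E; ring: w_rel.
split; split.
- by exists g111; rewrite expr0 mul1r.
- by exists b1; rewrite expr1 -g112E.
- by exists c1; rewrite expr1 -g121E.
- by exists e2; rewrite expr2 -mulrA -e1E -g122E.
- by exists g211; rewrite expr0 mul1r.
- by exists u; rewrite expr1 -g222E.
exists v; rewrite expr1 -Sv g222E !rmorphM /= -[iota y / iota x * _]mulrA.
by rewrite mulKr ?(loc_unit_x hL) // !linearD !linearZ /= rmorphM.
Qed.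

Lemma commutator_y a : exists t, y * a - a * y = x * t.
Proof.
have [eps [ex ey ker_eps]] := eval_x0 q_rel hA.
by apply: ker_eps; rewrite rmorphB !rmorphM /= mulrC subrr.
Qed.

Lemma xy_swap m : exists h, h * (x * y) = x * y * m.
Proof.
have [m1 e1] := muly_swapl q_rel hA m; have [h e2] := mulx_swapl hA m1.
by exists h; rewrite mulrA -e2 -!mulrA e1.
Qed.

Lemma x2y2_swap w m : exists h,
  h * (x ^+ 2 * y ^+ 2) = x ^+ 2 * w * y ^+ 2 + x ^+ 2 * y ^+ 2 * m.
Proof.
have [m1 e1] := muly_swapl q_rel hA m; have [m2 e2] := muly_swapl q_rel hA m1.
have [h1 e3] := mulx_swapl hA (w + m2); have [h2 e4] := mulx_swapl hA h1.
have e12 : y ^+ 2 * m = m2 * y ^+ 2 by rewrite !expr2 -mulrA e1 mulrA e2 -mulrA.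
have e34 : x ^+ 2 * (w + m2) = h2 * x ^+ 2.
  by rewrite !expr2 -mulrA e3 mulrA e4 -mulrA.
by exists h2; rewrite mulrA -e34 mulrDr mulrDl -[_ * _ * m]mulrA e12 mulrA.
Qed.

Lemma solvable_cleared_symbols g : solvability_conditions q iota x y g ->
  exists h, cleared_symbols q x y g h.
Proof.
rewrite /solvability_conditions /in_xnA /cleared_symbols.
case=> [[_ [b1]]]; rewrite ?expr1 => /(loc_inj hL) ->.
case=> c1; rewrite ?expr1 => /(loc_inj hL) -> [e2 /(loc_inj hL) ->].
case=> _ [u]; rewrite ?expr1 => /(loc_inj hL) -> [v].
rewrite ?expr1 (rmorphM iota x u) -[iota y / iota x * _]mulrA mulKr ?(loc_unit_x hL) //.
rewrite -(rmorphM iota y u) -!linearZ -!linearD => /(loc_inj hL).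
move: (g i1 i1 i1) (g i2 i1 i1) (g i2 i1 i2) (g i2 i2 i1) => g111 g211 g212 g221 Sv.
have [ta ea] := commutator_y g111.
have [tb eb] := commutator_y b1.
have [tc ec] := commutator_y c1.
(* In these witnesses the coefficients of [cleared_symbols] are multiplied by powers of [q] coming
   from [y * x = q ^+ 2 *: (x * y)], used to bring each [x] to the front. *)
have [h111 E111] := xy_swap (q ^+ 2 *: g111 + ((1 - q) * q) *: (y * b1)
  + ((q ^+ 2 - 1) * q) *: (y * c1)).
have [h112 E112] := xy_swap ((q ^+ 2 - 1) *: (x * b1) + q *: (x * c1)
  + (q - q ^+ 2) *: (x * y * e2)).
have [h121 E121] := xy_swap (q *: (x * b1) + (1 - q) *: (x * y * e2)).
have [h122 E122] := xy_swap (q ^+ 2 *: (x ^+ 2 * e2)).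
have [h211 E211] := x2y2_swap (ta - ((1 - q ^+ 2) * q ^+ 2) *: (y * tb)
  - ((q ^+ 2 - q) * q ^+ 2) *: (y * tc) + v * y) (q ^+ 2 *: g211).
have [h212 E212] := x2y2_swap ((1 - q ^+ 2) *: (b1 * y)
  + ((q ^+ 2 - 1) * q ^+ 2) *: (y ^+ 2 * e2) + ((1 - q) * q ^+ 2) *: (y * b1)
  + (q ^+ 2 * q ^+ 2) *: (y * c1) - q *: (c1 * y) + ((q - 1) * q) *: (y * e2 * y)
  + (q ^+ 2 - q) *: (u * y)) ((q ^+ 2 - 1) *: g212 + q *: g221).
have [h221 E221] := x2y2_swap ((q ^+ 2 * q ^+ 2) *: (y * b1) - q *: (b1 * y)
  + ((1 - q ^+ 2) * q) *: (y * e2 * y) + ((q - q ^+ 2) * q ^+ 2) *: (y ^+ 2 * e2)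
  + (q - 1) *: (u * y)) (q *: g212).
have [h222 E222] := x2y2_swap (q ^+ 2 *: (y * x * e2) - q *: (x * e2 * y))
  (q ^+ 2 *: (x * u)).
exists (fun i j k =>
  if i == i1 then if j == i1 then if k == i1 then h111 else h112
                  else if k == i1 then h121 else h122
  else if j == i1 then if k == i1 then h211 else h212
       else if k == i1 then h221 else h222).
rewrite /= E111 E112 E121 E122 E211 E212 E221 E222.
split; split; try by qplane q_rel xy_rel y3c.
(* Divisibility on the right by [x ^+ 2 * y ^+ 2] requires a second factor [x]. The terms in [g111],
   [b1] and [c1] combine into commutators with [y], which supply it, and the rest is the combination
   that the last condition places in xA. *)
transitivity (x * ((y * g111 - g111 * y) - (1 - q ^+ 2) *: (y * (y * b1 - b1 * y))
  - (q ^+ 2 - q) *: (y * (y * c1 - c1 * y)) + ((q - 1) *: g212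
  + (1 - q ^+ 2) *: g221 + (3 * q ^+ 2) *: (y * u)) * y) * y ^+ 2
  + x ^+ 2 * y ^+ 2 * (q ^+ 2 *: g211)); last by qplane q_rel xy_rel y3c.
by rewrite ea eb ec Sv; qplane q_rel xy_rel y3c.
Qed.

End Solvability.

(** * Forms and the centre of the bimodule of forms *)

Section Bimodules.

Variables (C : fieldType) (A : algType C) (M : bimodType A).

Lemma ract_additive a : forall u v : M, (u - v) *r a = u *r a - v *r a.
Proof. by move=> u v; apply: (canRL (addrK _)); rewrite -ractDl subrK. Qed.

Lemma ract0l a : (0 : M) *r a = 0.
Proof. by rewrite -[0 in LHS](subrr 0) ract_additive subrr. Qed.

Lemma scalar_ract (k : C) (u : M) a : k%:A *: (u *r a) = u *r (k *: a).
Proof. by rewrite -lractA -ract_scalar ractA mulr_algl. Qed.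

Lemma alg_scaler (k : C) a (u : M) : (k *: a) *: u = k%:A *: (a *: u).
Proof. by rewrite scalerA mulr_algl. Qed.

Lemma ract0r (u : M) : u *r 0 = 0.
Proof. by rewrite -(scale0r (1 : A)) ract_scalar !scale0r. Qed.

Lemma ractNr (u : M) a : u *r (- a) = - (u *r a).
Proof. by apply/eqP; rewrite -addr_eq0 -ractDr addNr ract0r. Qed.

End Bimodules.

Section Forms.

Variables (C : fieldType) (q : C) (A : algType C) (x y : A).
Hypotheses (q_rel : q ^+ 2 = - q - 1) (three_neq0 : 3 != 0 :> C).
Hypothesis hA : quantum_plane q x y.
Variables (L : unitAlgType C) (iota : {lrmorphism A -> L}).
Hypothesis hL : localization x y iota.
Variables (M : bimodType A) (xi eta : M).
Hypothesis hM : quantum_plane_forms q x y xi eta.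
Variable d : A -> M.
Hypotheses (hd : derivation d) (hdx : d x = xi) (hdy : d y = eta).

Let xy_rel : x * y = q *: (y * x) := qplane_rel hA.
Let y3c : forall a, a * y ^+ 3 = y ^+ 3 * a := y3_central q_rel hA.

Definition oneform (a b : A) : M := xi *r a + eta *r b.

Lemma form_surj m : exists a b, m = oneform a b.
Proof. by have [[a b] [-> _]] := forms_right_free hM m; exists a, b. Qed.

Lemma form_inj a b a' b' : oneform a b = oneform a' b' -> a = a' /\ b = b'.
Proof.
move=> e; have [c [_ uniq_c]] := forms_right_free hM (oneform a b).
have := uniq_c (a, b) erefl; rewrite (uniq_c (a', b') e).
by case.
Qed.

Lemma form_coords : exists c : M -> A * A,
  (forall m, m = oneform (c m).1 (c m).2) /\ (forall a b, c (oneform a b) = (a, b)).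
Proof.
have [c cE] := choice (fun m => forms_right_free hM m).
have formE m : m = oneform (c m).1 (c m).2 by have [] := cE m.
exists c; split=> // a b.
by have [] := form_inj (esym (formE (oneform a b))); case: (c _) => ? ? /= -> ->.
Qed.

Lemma formD a b a' b' : oneform a b + oneform a' b' = oneform (a + a') (b + b').
Proof. by rewrite /oneform !ractDr addrACA. Qed.

Lemma formZ k a b : k%:A *: oneform a b = oneform (k *: a) (k *: b).
Proof. by rewrite /oneform scalerDr !scalar_ract. Qed.

Lemma formN a b : - oneform a b = oneform (- a) (- b).
Proof. by rewrite /oneform opprD !ractNr. Qed.

Lemma form_ract a b c : oneform a b *r c = oneform (a * c) (b * c).
Proof. by rewrite /oneform ractDl !ractA. Qed.

Lemma form00 : oneform 0 0 = 0.
Proof. by rewrite /oneform !ract0r addr0. Qed.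

Lemma x_form a b : x *: oneform a b
  = oneform (q ^+ 2 *: (x * a) + (q ^+ 2 - 1) *: (y * b)) (q *: (x * b)).
Proof.
have [xxi xeta _ _] := forms_rel hM.
rewrite /oneform scalerDr -!lractA xxi xeta !ractDl !lractA !ractA !scalar_ract ractDr.
by rewrite [X in _ + X]addrC addrA.
Qed.

Lemma y_form a b : y *: oneform a b = oneform (q *: (y * a)) (q ^+ 2 *: (y * b)).
Proof.
have [_ _ yxi yeta] := forms_rel hM.
by rewrite /oneform scalerDr -!lractA yxi yeta !lractA !ractA !scalar_ract.
Qed.

Lemma xi_form : xi = oneform 1 0.
Proof. by rewrite /oneform ract1 ract0r addr0. Qed.

Lemma eta_form : eta = oneform 0 1.
Proof. by rewrite /oneform ract1 ract0r add0r. Qed.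

Lemma x_xi : x *: xi = oneform (q ^+ 2 *: x) 0.
Proof. by rewrite xi_form x_form !mulr0 !scaler0 addr0 mulr1. Qed.

Lemma x_eta : x *: eta = oneform ((q ^+ 2 - 1) *: y) (q *: x).
Proof. by rewrite eta_form x_form mulr0 !scaler0 add0r !mulr1. Qed.

Lemma y_xi : y *: xi = oneform (q *: y) 0.
Proof. by rewrite xi_form y_form !mulr0 !scaler0 mulr1. Qed.

Lemma y_eta : y *: eta = oneform 0 (q ^+ 2 *: y).
Proof. by rewrite eta_form y_form mulr0 !scaler0 mulr1. Qed.

Lemma derivationZ k a : d (k *: a) = k%:A *: d a.
Proof.
have [linD _] := hd.
have d0 : d 0 = 0.
  by have := linD (-1) 0 0; rewrite scaler0 addr0 !scaleN1r addNr.
by have := linD k a 0; rewrite addr0 d0 addr0.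
Qed.

Lemma derivationD a b : d (a + b) = d a + d b.
Proof. by have [linD _] := hd; have := linD 1 a b; rewrite !scale1r. Qed.

Lemma derivation1 : d 1 = 0.
Proof.
have [_ leib] := hd; apply: (@addrI _ (d 1)); rewrite addr0.
by have := leib 1 1; rewrite mulr1 ract1 scale1r => <-.
Qed.

(* Such a [c] is constant for connections: these commute with the action of [c]. *)
Definition form_central (c : A) : Prop :=
  [/\ forall a, c * a = a * c, d c = 0 & forall u : M, c *: u = u *r c].

Lemma form_central_linear : linear_pred form_central.
Proof.
move=> k a b [ca da ua] [cb db ub]; split=> [c||u].
- by rewrite mulrDl mulrDr -scalerAl -scalerAr ca cb.
- by rewrite derivationD derivationZ da db scaler0 addr0.
- by rewrite scalerDl ractDr alg_scaler ua ub scalar_ract.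
Qed.

Lemma form_centralM a b : form_central a -> form_central b -> form_central (a * b).
Proof.
move=> [ca da ua] [cb db ub]; split=> [c||u].
- by rewrite -mulrA cb mulrA ca mulrA.
- by have [_ ->] := hd; rewrite da db ract0l scaler0 addr0.
- by rewrite -scalerA ub ua ractA -ca.
Qed.

Lemma form_central1 : form_central 1.
Proof.
by split=> [a||u]; rewrite ?mul1r ?mulr1 ?derivation1 ?scale1r ?ract1.
Qed.

Lemma form_central_commute (c : A) : (forall a, c * a = a * c) -> d c = 0 ->
  c *: xi = xi *r c -> c *: eta = eta *r c -> form_central c.
Proof.
move=> cc dc cxi ceta; split=> // u; have [a [b ->]] := form_surj u.
by rewrite /oneform scalerDr ractDl -!lractA cxi ceta !ractA !cc.
Qed.

Ltac form_eq := congr oneform; qplane q_rel xy_rel y3c.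

Definition form_simp := (x_form, y_form, formD, formN, formZ, form_ract).

Lemma derivation_xy : d (x * y) = oneform (q ^+ 2 *: y) (q *: x).
Proof.
by have [_ ->] := hd; rewrite hdx hdy xi_form eta_form !form_simp; form_eq.
Qed.

Lemma derivation_x2y2 : d (x ^+ 2 * y ^+ 2) =
  oneform ((- q ^+ 2) *: (x * (y * y))) ((- 1) *: (x * (x * y))).
Proof.
have [_ leib] := hd; rewrite !expr2 -mulrA !leib hdx hdy xi_form eta_form.
by rewrite !form_simp; form_eq.
Qed.

Lemma derivation_xy3 : d (x * y ^+ 3) = oneform (y * (y * y)) 0.
Proof.
have [_ leib] := hd; rewrite !exprS expr0 mulr1 !leib hdx hdy xi_form eta_form.
by rewrite !form_simp; form_eq.
Qed.

(** Both the differential of x^3 and the [xi] component of x^3 [eta] carry the factor 1 + q + q^2 =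
    0. *)
Lemma form_central_x3 : form_central (x ^+ 3).
Proof.
have [_ leib] := hd.
apply: form_central_commute => [a|||].
- by rewrite (x3_central q_rel hA).
- rewrite (_ : x ^+ 3 = x * (x * x)); last by rewrite !exprS expr0 mulr1.
  by rewrite !leib hdx xi_form -form00 !form_simp; form_eq.
- rewrite (_ : x ^+ 3 *: xi = x *: (x *: (x *: xi))); last first.
    by rewrite !scalerA !exprS expr0 mulr1 !mulrA.
  by rewrite xi_form !form_simp; form_eq.
- rewrite (_ : x ^+ 3 *: eta = x *: (x *: (x *: eta))); last first.
    by rewrite !scalerA !exprS expr0 mulr1 !mulrA.
  by rewrite eta_form !form_simp; form_eq.
Qed.

Lemma form_central_y3 : form_central (y ^+ 3).
Proof.
have [_ leib] := hd.
apply: form_central_commute => [a|||].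
- by rewrite y3c.
- rewrite (_ : y ^+ 3 = y * (y * y)); last by rewrite !exprS expr0 mulr1.
  by rewrite !leib hdy eta_form -form00 !form_simp; form_eq.
- rewrite (_ : y ^+ 3 *: xi = y *: (y *: (y *: xi))); last first.
    by rewrite !scalerA !exprS expr0 mulr1 !mulrA.
  by rewrite xi_form !form_simp; form_eq.
- rewrite (_ : y ^+ 3 *: eta = y *: (y *: (y *: eta))); last first.
    by rewrite !scalerA !exprS expr0 mulr1 !mulrA.
  by rewrite eta_form !form_simp; form_eq.
Qed.

Lemma form_central_monomial k l : form_central (y ^+ (3 * k) * x ^+ (3 * l)).
Proof.
have pow c n : form_central c -> form_central (c ^+ n).
  move=> cc; elim: n => [|n IH]; first exact: form_central1.
  by rewrite exprS; apply: form_centralM.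
rewrite !exprM; apply: form_centralM; apply: pow.
  exact: form_central_y3.
exact: form_central_x3.
Qed.

Definition center1 : M := oneform (x * y) 0.
Definition center2 : M := oneform (- q *: (x * y ^+ 3)) (x ^+ 2 * y ^+ 2).

Lemma bimod_center_gen (u : M) :
  x *: u = u *r x -> y *: u = u *r y -> bimod_center u.
Proof.
move=> ux uy; apply: (qplane_gen hA).
- by move=> a [] ->.
- by rewrite scale1r ract1.
- by move=> k a b ua ub; rewrite scalerDl ractDr alg_scaler ua ub scalar_ract.
- by move=> a b ua ub; rewrite -scalerA ub -lractA ua ractA.
Qed.

Lemma center1P : bimod_center center1.
Proof. by apply: bimod_center_gen; rewrite !form_simp; form_eq. Qed.

Lemma center2P : bimod_center center2.
Proof. by apply: bimod_center_gen; rewrite !form_simp; form_eq. Qed.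

(* The left Leibniz rule needs the generators written with coefficients on the left. *)
Lemma center1_left : center1 = (x * y) *: xi.
Proof. by rewrite -scalerA xi_form !form_simp; form_eq. Qed.

Lemma center2_left : center2 = (x ^+ 2 * y ^+ 2) *: eta - (x * y ^+ 3) *: xi.
Proof.
rewrite !exprS !expr0 !mulr1 -!scalerA xi_form eta_form !form_simp; form_eq.
Qed.

(** The relations are triangular: the [eta] coefficient satisfies eigenvalue equations by itself and
    yields [c2]; after subtraction of [center2 *r c2] the [xi] coefficient does so too and yields
    [c1]. *)
Lemma bimod_center_decomp (u : M) : bimod_center u -> exists c1 c2,
  [/\ form_central c1, form_central c2 & u = center1 *r c1 + center2 *r c2].
Proof.
have [a [b ->]] := form_surj u => cu.
have [] := form_inj (etrans (esym (x_form a b)) (etrans (cu x) (form_ract a b x))).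
have [] := form_inj (etrans (esym (y_form a b)) (etrans (cu y) (form_ract a b y))).
move=> ya yb xa xb {cu}.
have lZ := form_central_linear.
have Zc z : form_central z -> forall a, z * a = a * z by case.
have [z Zz ez] : exists2 z, form_central z & b = y ^+ 2 * x ^+ 2 * z.
  apply: (eigen_y2x2 q_rel three_neq0 hA hL lZ form_central_monomial Zc).
    by rewrite -xb; qplane q_rel xy_rel y3c.
  by rewrite -yb.
(* The factor is the cost of reordering: y^2x^2 = q^2 x^2y^2. *)
pose c2 := q ^+ 2 *: z.
have Zc2 : form_central c2 by apply: linear_predZ.
have eb : b = x ^+ 2 * y ^+ 2 * c2 by rewrite ez /c2; qplane q_rel xy_rel y3c.
have c2x := Zc _ Zc2 x; have c2y := Zc _ Zc2 y.
(* This is the [xi] coefficient of [u - center2 *r c2]. *)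
pose a' := a + q *: (x * y ^+ 3 * c2).
have xa' : x * a' = q *: (a' * x).
  rewrite /a' mulrDl -xa -scalerAl -[_ * c2 * x]mulrA c2x eb.
  by qplane q_rel xy_rel y3c.
have ya' : a' * y = q *: (y * a').
  rewrite /a' mulrDl -ya -scalerAl -[_ * c2 * y]mulrA c2y.
  by qplane q_rel xy_rel y3c.
(* The exponents of [a'] are 1 modulo 3; multiplying by [y] and [x] shifts them to 2, so that
   [eigen_y2x2] applies again, and both factors are cancelled afterwards. *)
have [z' Zz' ez'] : exists2 z, form_central z & y * a' * x = y ^+ 2 * x ^+ 2 * z.
  apply: (eigen_y2x2 q_rel three_neq0 hA hL lZ form_central_monomial Zc).
    transitivity (q *: (y * (x * a') * x)); first by qplane q_rel xy_rel y3c.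
    by rewrite xa'; qplane q_rel xy_rel y3c.
  transitivity (q *: (y * (a' * y) * x)); first by qplane q_rel xy_rel y3c.
  by rewrite ya'; qplane q_rel xy_rel y3c.
exists (q ^+ 2 *: z'), c2; split=> //; first exact: linear_predZ.
rewrite !form_simp eb; congr oneform; last by qplane q_rel xy_rel y3c.
have ea' : a' = y * x * z'.
  apply: (y_lreg hL); apply: (x_rreg hL).
  by rewrite /= ez' -[_ * x in RHS]mulrA -[_ * z' * x]mulrA (Zc _ Zz' x) !expr2 !mulrA.
have -> : a = a' - q *: (x * y ^+ 3 * c2) by rewrite /a' addrK.
by rewrite ea'; qplane q_rel xy_rel y3c.
Qed.

End Forms.

(** * Connections *)

Section Connections.

Variables (C : fieldType) (q : C) (A : algType C) (x y : A).
Hypotheses (q_rel : q ^+ 2 = - q - 1) (three_neq0 : 3 != 0 :> C).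
Hypothesis hA : quantum_plane q x y.
Variables (L : unitAlgType C) (iota : {lrmorphism A -> L}).
Hypothesis hL : localization x y iota.
Variables (M : bimodType A) (xi eta : M).
Hypothesis hM : quantum_plane_forms q x y xi eta.
Variable d : A -> M.
Hypotheses (hd : derivation d) (hdx : d x = xi) (hdy : d y = eta).
Variables (T : bimodType A) (tens : M -> M -> T).
Hypothesis hT : tensor_product tens.

Let xy_rel : x * y = q *: (y * x) := qplane_rel hA.
Let y3c : forall a, a * y ^+ 3 = y ^+ 3 * a := y3_central q_rel hA.
Local Notation oneform := (oneform xi eta).

Definition tform (a b c e : A) : T := tens xi (oneform a b) + tens eta (oneform c e).

Lemma tensDl m m' n : tens (m + m') n = tens m n + tens m' n.
Proof. by have [-> _ _] := tens_balanced hT. Qed.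

Lemma tensDr m n n' : tens m (n + n') = tens m n + tens m n'.
Proof. by have [_ -> _] := tens_balanced hT. Qed.

Lemma tens_ract m a n : tens (m *r a) n = tens m (a *: n).
Proof. by have [_ _ ->] := tens_balanced hT. Qed.

Lemma tens0r m : tens m 0 = 0.
Proof. by apply: (@addrI _ (tens m 0)); rewrite -tensDr !addr0. Qed.

Lemma tens0l n : tens 0 n = 0.
Proof. by apply: (@addrI _ (tens 0 n)); rewrite -tensDl !addr0. Qed.

Lemma tensNr m n : tens m (- n) = - tens m n.
Proof. by apply/eqP; rewrite -addr_eq0 -tensDr addNr tens0r. Qed.

Lemma tensZr k m n : tens m (k%:A *: n) = k%:A *: tens m n.
Proof. by rewrite -tens_ract ract_scalar (tens_left hT). Qed.

Lemma tens_form a b n : tens (oneform a b) n = tens xi (a *: n) + tens eta (b *: n).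
Proof. by rewrite /oneform tensDl !tens_ract. Qed.

Lemma tens_xi_form a b : tens xi (oneform a b) = tform a b 0 0.
Proof. by rewrite /tform form00 tens0r addr0. Qed.

Lemma tens_eta_form a b : tens eta (oneform a b) = tform 0 0 a b.
Proof. by rewrite /tform form00 tens0r add0r. Qed.

Lemma tens_surj t : exists m n, t = tens xi m + tens eta n.
Proof.
move: t; apply: (tens_gen hT).
- by move=> m n; have [a [b ->]] := form_surj hM m; exists (a *: n), (b *: n);
    rewrite tens_form.
- by exists 0, 0; rewrite !tens0r addr0.
- move=> _ _ [m [n ->]] [m' [n' ->]]; exists (m - m'), (n - n').
  by rewrite !tensDr !tensNr opprD addrACA.
Qed.

(* The balanced map sending [m], [n] to the pair [(a *: n, b *: n)], where
   [m = oneform a b], is a left inverse of [(n1, n2) |-> tens xi n1 + tens eta n2]. *)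
Lemma tens_inj m n m' n' :
  tens xi m + tens eta n = tens xi m' + tens eta n' -> m = m' /\ n = n'.
Proof.
have [c [formE c_form]] := form_coords hM.
pose f m0 n0 : (M * M)%type := ((c m0).1 *: n0, (c m0).2 *: n0).
have [|g gE] := tens_univ hT (f := f).
  split=> [m0 m1 n0|m0 n0 n1|m0 a n0]; rewrite /f.
  - have -> : c (m0 + m1) = ((c m0).1 + (c m1).1, (c m0).2 + (c m1).2).
      by rewrite {1}(formE m0) {1}(formE m1) formD c_form.
    by rewrite /= !scalerDl.
  - by rewrite !scalerDr.
  - have -> : c (m0 *r a) = ((c m0).1 * a, (c m0).2 * a).
      by rewrite {1}(formE m0) form_ract c_form.
    by rewrite /= !scalerA.
move=> /(congr1 g); rewrite !raddfD /= !gE /f.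
have -> : c xi = (1, 0) by rewrite [X in c X](xi_form xi eta) c_form.
have -> : c eta = (0, 1) by rewrite [X in c X](eta_form xi eta) c_form.
by rewrite /= !scale1r !scale0r => -[]; rewrite !addr0 !add0r.
Qed.

Lemma tform_surj t : exists a b c e, t = tform a b c e.
Proof.
have [m [n ->]] := tens_surj t.
have [a [b ->]] := form_surj hM m; have [c [e ->]] := form_surj hM n.
by exists a, b, c, e.
Qed.

Lemma tform_inj a b c e a' b' c' e' :
  tform a b c e = tform a' b' c' e' -> [/\ a = a', b = b', c = c' & e = e'].
Proof. by case/tens_inj=> /(form_inj hM)[-> ->] /(form_inj hM)[-> ->]. Qed.

Lemma tformD a b c e a' b' c' e' :
  tform a b c e + tform a' b' c' e' = tform (a + a') (b + b') (c + c') (e + e').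
Proof. by rewrite /tform addrACA -!tensDr !formD. Qed.

Lemma tformN a b c e : - tform a b c e = tform (- a) (- b) (- c) (- e).
Proof. by rewrite /tform opprD -!tensNr !formN. Qed.

Lemma tform_ract a b c e u :
  tform a b c e *r u = tform (a * u) (b * u) (c * u) (e * u).
Proof. by rewrite /tform ractDl -!(tens_right hT) !form_ract. Qed.

Lemma tformZ k a b c e :
  k%:A *: tform a b c e = tform (k *: a) (k *: b) (k *: c) (k *: e).
Proof.
rewrite -ract_scalar tform_ract.
by congr tform; rewrite -scalerAr mulr1.
Qed.

Ltac tform_eq := congr tform; qplane q_rel xy_rel y3c.

Lemma x_tform a b c e : x *: tform a b c e =
  tform (q *: (x * a) + (q - q ^+ 2) *: (y * b) + (1 - q) *: (y * c))
    (x * b + (q - q ^+ 2) *: (y * e)) (x * c + (1 - q) *: (y * e)) (q ^+ 2 *: (x * e)).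
Proof.
rewrite {1}/tform scalerDr -!(tens_left hT) (x_xi hM) (x_eta hM) !tens_form.
rewrite !(alg_scaler _ x, alg_scaler _ y).
rewrite scale0r tens0r addr0 addrA -tensDr !(x_form hM, y_form hM, formZ, formD).
rewrite -/(tform _ _ _ _); tform_eq.
Qed.

Lemma y_tform a b c e : y *: tform a b c e =
  tform (q ^+ 2 *: (y * a)) (y * b) (y * c) (q *: (y * e)).
Proof.
rewrite {1}/tform scalerDr -!(tens_left hT) (y_xi hM) (y_eta hM) !tens_form.
rewrite !(alg_scaler _ y).
rewrite !scale0r !tens0r addr0 add0r !(x_form hM, y_form hM, formZ, formD).
rewrite -/(tform _ _ _ _); tform_eq.
Qed.

Lemma form_central_tens c (t : T) : form_central (M := M) d c -> c *: t = t *r c.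
Proof.
move=> [_ _ cu]; have [m [n ->]] := tens_surj t.
rewrite scalerDr ractDl -!(tens_left hT) !cu !tens_ract !cu.
by rewrite !(tens_right hT).
Qed.

Lemma christoffelE (nabla : M -> T) G : christoffel tens xi eta nabla G <->
  nabla xi = tform (G i1 i1 i1) (G i1 i1 i2) (G i1 i2 i1) (G i1 i2 i2) /\
  nabla eta = tform (G i2 i1 i1) (G i2 i1 i2) (G i2 i2 i1) (G i2 i2 i2).
Proof.
have tformE g : \sum_(j < 2) \sum_(k < 2)
    tens (theta xi eta j) (theta xi eta k) *r g j k
  = tform (g i1 i1) (g i1 i2) (g i2 i1) (g i2 i2).
  rewrite !big_ord_recr !big_ord0 /= !add0r /tform /form !tensDr !(tens_right hT).
  rewrite (_ : widen_ord _ _ = i1); last exact: val_inj.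
  by rewrite (_ : ord_max = i2).
split=> [nablaG|[n1 n2] i]; last first.
  rewrite tformE.
  case: i => [[|[|//]] lt_i]; first by rewrite (_ : Ordinal _ = i1); last exact: val_inj.
  by rewrite (_ : Ordinal _ = i2); last exact: val_inj.
by split; [move: (nablaG i1) | move: (nablaG i2)]; rewrite tformE.
Qed.

(** As [xi], [eta] is a right basis, the Leibniz rule itself defines the connection: [oneform a b]
    goes to [t1 *r a + tens xi (d a) + t2 *r b + tens eta (d b)]. *)
Lemma right_connection_exists (t1 t2 : T) : exists nabla : M -> T,
  [/\ right_connection tens d nabla, nabla xi = t1 & nabla eta = t2].
Proof.
have [c [formE c_form]] := form_coords hM; have [linD leib] := hd.
pose f (t : T) (m : M) a := t *r a + tens m (d a).
have f_lin t m k a b : f t m (k *: a + b) = k%:A *: f t m a + f t m b.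
  by rewrite /f ractDr -scalar_ract linD tensDr tensZr scalerDr addrACA.
have f_leib t m a b : f t m (a * b) = f t m a *r b + tens (m *r a) (d b).
  rewrite /f leib tensDr (tens_right hT) tens_ract -ractA ractDl.
  by rewrite addrA.
have d1 := derivation1 hd.
have d0 : d 0 = 0 by rewrite -(scale0r (1 : A)) (derivationZ hd) d1 scaler0.
exists (fun m => f t1 xi (c m).1 + f t2 eta (c m).2); split.
- split=> [k u v|z a].
    have -> : c (k%:A *: u + v) = (k *: (c u).1 + (c v).1, k *: (c u).2 + (c v).2).
      by rewrite {1}(formE u) {1}(formE v) formZ formD c_form.
    by rewrite /= !f_lin [in RHS]scalerDr addrACA.
  have -> : c (z *r a) = ((c z).1 * a, (c z).2 * a).
    by rewrite {1}(formE z) form_ract c_form.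
  by rewrite /= !f_leib addrACA [in RHS]ractDl -tensDl -/(oneform _ _) -formE.
- rewrite [X in c X](xi_form xi eta) c_form /f /= d0 d1 !tens0r ract1 ract0r.
  by rewrite !(add0r, addr0).
- rewrite [X in c X](eta_form xi eta) c_form /f /= d0 d1 !tens0r ract1 ract0r.
  by rewrite !(add0r, addr0).
Qed.

Lemma christoffel_exists (nabla : M -> T) : exists G, christoffel tens xi eta nabla G.
Proof.
have [a [b [c [e n1]]]] := tform_surj (nabla xi).
have [a' [b' [c' [e' n2]]]] := tform_surj (nabla eta).
exists (fun i j k => if i == i1 then if j == i1 then if k == i1 then a else b
                                     else if k == i1 then c else e
                     else if j == i1 then if k == i1 then a' else b'
                          else if k == i1 then c' else e').
exact/christoffelE.
Qed.

Variable sigma : T -> T.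
Hypothesis hsigma : braiding q tens xi eta sigma.

Lemma sigma_tform a b c e : sigma (tform a b c e) =
  tform (q *: a) (q ^+ 2 *: c) (q ^+ 2 *: b - (1 - q) *: c) (q *: e).
Proof.
have [[sD _ sR] _ [s11 s12 s21 s22]] := hsigma.
have qV : q^-1 = q ^+ 2.
  by apply: (mulfI (q_neq0 q_rel)); rewrite divff ?(q_neq0 q_rel) //; ring: q_rel.
have qV2 : q ^- 2 = q by rewrite -exprVn qV; ring: q_rel.
rewrite {1}/tform /oneform !tensDr !(tens_right hT) !sD !sR s11 s12 s21 s22 qV qV2.
have -> : tens xi xi = tform 1 0 0 0.
  by rewrite -tens_xi_form -(xi_form xi eta).
have -> : tens xi eta = tform 0 1 0 0.
  by rewrite -tens_xi_form -(eta_form xi eta).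
have -> : tens eta xi = tform 0 0 1 0.
  by rewrite -tens_eta_form -(xi_form xi eta).
have -> : tens eta eta = tform 0 0 0 1.
  by rewrite -tens_eta_form -(eta_form xi eta).
rewrite !(tformZ, tformN, tformD, tform_ract); tform_eq.
Qed.

Lemma tens_sigma1 : tens (d (x * y)) xi = sigma (tens xi (d (x * y))).
Proof.
rewrite (derivation_xy q_rel hA hM hd hdx hdy) tens_form tens_xi_form sigma_tform.
rewrite !(alg_scaler _ x, alg_scaler _ y) (x_xi hM) (y_xi hM) !formZ.
rewrite tens_xi_form tens_eta_form tformD; tform_eq.
Qed.

Lemma tens_sigma2 :
  tens (d (x ^+ 2 * y ^+ 2)) eta - tens (d (x * y ^+ 3)) xi =
  sigma (tens eta (d (x ^+ 2 * y ^+ 2)) - q%:A *: tens xi (d (x * y ^+ 3))).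
Proof.
rewrite (derivation_x2y2 q_rel hA hM hd hdx hdy) (derivation_xy3 q_rel hA hM hd hdx hdy).
rewrite !tens_form tens_xi_form tens_eta_form tformZ tformN tformD sigma_tform.
rewrite scale0r tens0r addr0 !(alg_scaler _ (x * (y * y)), alg_scaler _ (x * (x * y))).
rewrite -!scalerA (y_xi hM) (y_eta hM) !(x_form hM, y_form hM, formZ).
rewrite !(tens_xi_form, tens_eta_form, tformN, tformD); tform_eq.
Qed.

Variables nablaL nablaR : M -> T.
Hypothesis hnablaL : left_connection tens d nablaL.
Hypothesis hR : right_connection tens d nablaR.

Lemma Clinear_additive (N P : bimodType A) (f : N -> P) : Clinear f ->
  forall u v, f (u + v) = f u + f v.
Proof. by move=> lf u v; have := lf 1 u v; rewrite !scale1r. Qed.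

(** For a constant [c] the Leibniz terms with [d c] vanish and [c] commutes with all tensors, so the
    compatibility equation at [z] implies the one at [z *r c]. *)
Lemma sigma_compatible_center : sigma_compatible sigma nablaL nablaR <->
  nablaL (center1 x y xi eta) = sigma (nablaR (center1 x y xi eta)) /\
  nablaL (center2 q x y xi eta) = sigma (nablaR (center2 q x y xi eta)).
Proof.
have [lL leibL] := hnablaL; have [lR leibR] := hR.
have [[sD _ sR] _ _] := hsigma.
split=> [cpt|[cpt1 cpt2] u cu].
  by split; apply: cpt; [apply: center1P|apply: center2P]; eassumption.
have [c1 [c2 [Zc1 Zc2 ->]]] :=
  bimod_center_decomp q_rel three_neq0 hA hL hM hd hdx hdy cu.
rewrite !(Clinear_additive lL, Clinear_additive lR, sD).
have cz z c : form_central d c -> nablaL z = sigma (nablaR z) ->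
    nablaL (z *r c) = sigma (nablaR (z *r c)).
  move=> Zc ez; have [_ dc cz] := Zc.
  rewrite leibR -cz leibL dc tens0l tens0r add0r addr0 sR -ez.
  exact: form_central_tens.
by rewrite !cz.
Qed.

Variables g h : 'I_2 -> 'I_2 -> 'I_2 -> A.
Hypotheses (hg : christoffel tens xi eta nablaL g)
  (hh : christoffel tens xi eta nablaR h).

(* Both sides of the compatibility equation at a generator of the centre carry a
   term from the Leibniz rule that does not involve the connections; by
   [tens_sigma1] and [tens_sigma2] these terms cancel. *)
Lemma compat_center1 :
  nablaL (center1 x y xi eta) = sigma (nablaR (center1 x y xi eta)) <->
  (x * y) *: nablaL xi = sigma (nablaR xi) *r (x * y).
Proof.
have [_ leibL] := hnablaL; have [_ leibR] := hR; have [[sD _ sR] _ _] := hsigma.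
rewrite {1}(center1_left q_rel hA hM) leibL.
have -> : center1 x y xi eta = xi *r (x * y).
  by rewrite /center1 /oneform ract0r addr0.
rewrite leibR sD sR tens_sigma1 addrC.
by split=> [/addIr|->].
Qed.

Lemma compat_center2 : (x * y) *: nablaL xi = sigma (nablaR xi) *r (x * y) ->
  nablaL (center2 q x y xi eta) = sigma (nablaR (center2 q x y xi eta)) <->
  (x ^+ 2 * y ^+ 2) *: nablaL eta - (x *: nablaL xi) *r (y * (y * y))
    + (((x * y) *: nablaL xi) *r (q *: (y * y)))
  = sigma (nablaR eta) *r (x ^+ 2 * y ^+ 2).
Proof.
have [lL leibL] := hnablaL; have [lR leibR] := hR; have [[sD sL sR] _ _] := hsigma.
have aL := Clinear_additive lL; have aR := Clinear_additive lR.
move=> e1; rewrite {1}(center2_left q_rel hA hM).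
have nablaLN u : nablaL (- u) = - nablaL u.
  have nL0 : nablaL 0 = 0 by apply: (@addrI _ (nablaL 0)); rewrite -aL !addr0.
  by apply/eqP; rewrite -addr_eq0 -aL addNr nL0.
rewrite aL nablaLN !leibL.
have -> : center2 q x y xi eta = eta *r (x ^+ 2 * y ^+ 2) + xi *r ((- q) *: (x * y ^+ 3)).
  by rewrite /center2 /oneform addrC.
rewrite aR !leibR (derivationZ hd) tensZr.
have -> : (- q)%:A *: tens xi (d (x * y ^+ 3)) = - (q%:A *: tens xi (d (x * y ^+ 3))).
  by rewrite !scaleNr.
rewrite opprD addrACA [X in sigma X]addrACA [X in sigma X]addrC sD -tens_sigma2 sD !sR.
(* Here [e1] enters: splitting [x * y ^+ 3] as [x * y] times [y ^+ 2] eliminates [nablaR xi], so the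
   second equation involves only [nablaR eta]. *)
have -> : sigma (nablaR xi) *r ((- q) *: (x * y ^+ 3)) =
    - (((x * y) *: nablaL xi) *r (q *: (y * y))).
  by rewrite e1 ractA -ractNr; congr (_ *r _); qplane q_rel xy_rel y3c.
have -> : (x * y ^+ 3) *: nablaL xi = (x *: nablaL xi) *r (y * (y * y)).
  rewrite -scalerA (form_central_tens _ (form_central_y3 q_rel hA hM hd hdy)).
  by rewrite -lractA; congr (_ *r _); qplane q_rel xy_rel y3c.
split=> [/addrI ->|<-]; first by rewrite subrK.
by rewrite addrK.
Qed.

Lemma sigma_compatible_cleared :
  sigma_compatible sigma nablaL nablaR <-> cleared_symbols q x y g h.
Proof.
have [nLx nLe] := (christoffelE nablaL g).1 hg.
have [nRx nRe] := (christoffelE nablaR h).1 hh.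
rewrite /cleared_symbols.
move: (g i1 i1 i1) (g i1 i1 i2) (g i1 i2 i1) (g i1 i2 i2)
  (g i2 i1 i1) (g i2 i1 i2) (g i2 i2 i1) (g i2 i2 i2)
  (h i1 i1 i1) (h i1 i1 i2) (h i1 i2 i1) (h i1 i2 i2)
  (h i2 i1 i1) (h i2 i1 i2) (h i2 i2 i1) (h i2 i2 i2) nLx nLe nRx nRe =>
  g111 g112 g121 g122 g211 g212 g221 g222 h111 h112 h121 h122 h211 h212 h221 h222
  nLx nLe nRx nRe.
(* In this form the left action unfolds into single actions of [x] and [y], to which [x_tform] and
   [y_tform] apply. *)
have xE : x ^+ 2 * y ^+ 2 = x * (x * (y * y)) by rewrite !expr2 !mulrA.
split=> [/sigma_compatible_center[]|].
  move=> /compat_center1 e1 /(compat_center2 e1) e2.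
  move: e1 e2; rewrite xE -!scalerA nLx nLe nRx nRe.
  rewrite !(x_tform, y_tform, sigma_tform, tform_ract, tformN, tformD).
  move=> /tform_inj[e11 e12 e21 e22] /tform_inj[f11 f12 f21 f22].
  split.
    split.
    - transitivity (q ^+ 2 *: (q *: h111 * (x * y))); first by qplane q_rel xy_rel y3c.
      by rewrite -e11; qplane q_rel xy_rel y3c.
    (* On the two mixed components [sigma] is invertible but not diagonal; the added multiple of the
       other component removes the [h121] contribution. *)
    - transitivity (q *: ((q ^+ 2 *: h112 - (1 - q) *: h121) * (x * y))
        + (q * (1 - q) * q) *: (q ^+ 2 *: h121 * (x * y))).
        by qplane q_rel xy_rel y3c.
      by rewrite -e12 -e21; qplane q_rel xy_rel y3c.
    - transitivity (q *: (q ^+ 2 *: h121 * (x * y))); first by qplane q_rel xy_rel y3c.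
      by rewrite -e12; qplane q_rel xy_rel y3c.
    - transitivity (q ^+ 2 *: (q *: h122 * (x * y))); first by qplane q_rel xy_rel y3c.
      by rewrite -e22; qplane q_rel xy_rel y3c.
  split.
  - transitivity (q ^+ 2 *: (q *: h211 * (x * (x * (y * y))))).
      by qplane q_rel xy_rel y3c.
    by rewrite -f11; qplane q_rel xy_rel y3c.
  - transitivity (q *: ((q ^+ 2 *: h212 - (1 - q) *: h221) * (x * (x * (y * y))))
      + (q * (1 - q) * q) *: (q ^+ 2 *: h221 * (x * (x * (y * y))))).
      by qplane q_rel xy_rel y3c.
    by rewrite -f12 -f21; qplane q_rel xy_rel y3c.
  - transitivity (q *: (q ^+ 2 *: h221 * (x * (x * (y * y))))).
      by qplane q_rel xy_rel y3c.
    by rewrite -f12; qplane q_rel xy_rel y3c.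
  - transitivity (q ^+ 2 *: (q *: h222 * (x * (x * (y * y))))).
      by qplane q_rel xy_rel y3c.
    by rewrite -f22; qplane q_rel xy_rel y3c.
case=> [[e11 e12 e21 e22] [f11 f12 f21 f22]].
have e1 : (x * y) *: nablaL xi = sigma (nablaR xi) *r (x * y).
  rewrite -!scalerA nLx nRx !(x_tform, y_tform, sigma_tform, tform_ract).
  rewrite !(mulrBl, =^~ scalerAl) e11 e12 e21 e22; tform_eq.
apply/sigma_compatible_center; split; first exact/compat_center1.
apply/(compat_center2 e1).
rewrite xE -!scalerA nLx nLe nRe.
rewrite !(x_tform, y_tform, sigma_tform, tform_ract, tformN, tformD) -xE.
rewrite !(mulrBl, =^~ scalerAl) f11 f12 f21 f22; tform_eq.
Qed.

End Connections.

(** * Passage between the localization and the quantum plane *)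

Section Localization.

Variables (C : fieldType) (q : C) (A : algType C) (x y : A).
Variables (L : unitAlgType C) (iota : {lrmorphism A -> L}).
Hypothesis hL : localization x y iota.

(** Right multiplication by the units [x * y] and [x ^+ 2 * y ^+ 2] of the localization is
    reversible. Terms ending in [x ^- 2] alone keep a [y ^+ 2], which explains that factor in
    [cleared_symbols]. *)
Lemma solution_symbols_cleared g h :
  solution_symbols q (iota x) (iota y) (fun i j k => iota (g i j k))
    (fun i j k => iota (h i j k)) <-> cleared_symbols q x y g h.
Proof.
have ux := loc_unit_x hL; have uy := loc_unit_y hL.
have ux2 : iota x ^+ 2 \is a GRing.unit by rewrite unitrX.
have uy2 : iota y ^+ 2 \is a GRing.unit by rewrite unitrX.
have iotaD a b : iota (a + b) = iota a + iota b := rmorphD iota a b.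
have iotaN a : iota (- a) = - iota a := rmorphN iota a.
have iotaM a b : iota (a * b) = iota a * iota b := rmorphM iota a b.
have iotaX a n : iota (a ^+ n) = iota a ^+ n := rmorphXn iota n a.
have iotaZ k a : iota (k *: a) = k *: iota a by exact: linearZ.
have clear1 w : w * (iota y)^-1 * (iota x)^-1 * (iota x * iota y) = w.
  by rewrite mulrA mulrVK // mulrVK.
have clear2 w : w * iota x ^- 2 * (iota x ^+ 2 * iota y ^+ 2) = w * iota y ^+ 2.
  by rewrite mulrA mulrVK.
have clear3 w : w * iota y ^- 2 * iota x ^- 2 * (iota x ^+ 2 * iota y ^+ 2) = w.
  by rewrite mulrA mulrVK // mulrVK.
have clear u a b r : iota u \is a GRing.unit -> r * iota u = iota b ->
    iota a = r <-> a * u = b.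
  move=> uu rb; split=> [ar|ab].
    by apply: (loc_inj hL); rewrite iotaM ar rb.
  by apply: (mulIr uu); rewrite rb -ab iotaM.
have uxy : iota (x * y) \is a GRing.unit by rewrite iotaM unitrMr.
have ux2y2 : iota (x ^+ 2 * y ^+ 2) \is a GRing.unit by rewrite iotaM !iotaX unitrMr.
have iff4 P1 P2 P3 P4 Q1 Q2 Q3 Q4 : P1 <-> Q1 -> P2 <-> Q2 -> P3 <-> Q3 -> P4 <-> Q4 ->
    [/\ P1, P2, P3 & P4] <-> [/\ Q1, Q2, Q3 & Q4].
  by move=> [? ?] [? ?] [? ?] [? ?]; split=> -[*]; split; auto.
have iff2 P1 P2 Q1 Q2 : P1 <-> Q1 -> P2 <-> Q2 -> (P1 /\ P2) <-> (Q1 /\ Q2).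
  by move=> [? ?] [? ?]; split=> -[*]; split; auto.
rewrite /solution_symbols /cleared_symbols.
apply: iff2; apply: iff4; (apply: clear => //;
  rewrite !(iotaD, iotaN, iotaZ, iotaM, iotaX) !(mulrDl, mulNr, =^~ scalerAl);
  by rewrite !(clear3, clear1, clear2)).
Qed.

(** Since [x * y] and [x ^+ 2 * y ^+ 2] become units under the injective [iota], they can be
    cancelled on the right in [A]; the general solution is thus a single connection. *)
Lemma cleared_symbols_uniq g h h' :
  cleared_symbols q x y g h -> cleared_symbols q x y g h' ->
  forall i j k, h i j k = h' i j k.
Proof.
have uxy : iota (x * y) \is a GRing.unit.
  by rewrite rmorphM unitrMr ?(loc_unit_x hL) ?(loc_unit_y hL).
have ux2y2 : iota (x ^+ 2 * y ^+ 2) \is a GRing.unit.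
  rewrite rmorphM !rmorphXn /=.
  by rewrite unitrMr; apply: unitrX;
    first [exact: (loc_unit_x hL) | exact: (loc_unit_y hL)].
have reg u a b : iota u \is a GRing.unit -> a * u = b * u -> a = b.
  move=> uu /(congr1 iota); rewrite !rmorphM => /(mulIr uu).
  exact: (loc_inj hL).
case=> -[e1 e2 e3 e4] [f1 f2 f3 f4] [[e1' e2' e3' e4'] [f1' f2' f3' f4']].
have ord2 (P : 'I_2 -> Prop) : P i1 -> P i2 -> forall i, P i.
  move=> p1 p2 [[|[|//]] lt_i]; first by rewrite (_ : Ordinal _ = i1) //; apply: val_inj.
  by rewrite (_ : Ordinal _ = i2) //; apply: val_inj.
have ord2E (P : 'I_2 -> 'I_2 -> 'I_2 -> Prop) :
    (P i1 i1 i1 /\ P i1 i1 i2) /\ (P i1 i2 i1 /\ P i1 i2 i2) ->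
    (P i2 i1 i1 /\ P i2 i1 i2) /\ (P i2 i2 i1 /\ P i2 i2 i2) -> forall i j k, P i j k.
  by move=> [[? ?] [? ?]] [[? ?] [? ?]] i j k; move: i; apply: (ord2);
    move: j; apply: (ord2); move: k; apply: (ord2).
apply: ord2E; do 2!split.
- by apply: (reg (x * y)) => //; rewrite e1 e1'.
- by apply: (reg (x * y)) => //; rewrite e2 e2'.
- by apply: (reg (x * y)) => //; rewrite e3 e3'.
- by apply: (reg (x * y)) => //; rewrite e4 e4'.
- by apply: (reg (x ^+ 2 * y ^+ 2)) => //; rewrite f1 f1'.
- by apply: (reg (x ^+ 2 * y ^+ 2)) => //; rewrite f2 f2'.
- by apply: (reg (x ^+ 2 * y ^+ 2)) => //; rewrite f3 f3'.
- by apply: (reg (x ^+ 2 * y ^+ 2)) => //; rewrite f4 f4'.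
Qed.

End Localization.

(** * The primitive cube root of unity *)

Section CubeRoot.

Variable R : realType.

Lemma expi_add (s t : R) : expi (s + t) = expi s * expi t.
Proof. by rewrite /expi cosD sinD; simpc; congr Complex; rewrite addrC. Qed.

(** The addition formulas give q^3 = 1, and q differs from 1 because the sine is positive on (0,
    pi); so [q - 1] can be cancelled from q^3 - 1. *)
Lemma q3_rel : q3 R ^+ 2 = - q3 R - 1.
Proof.
pose t : R := 2 * pi / 3.
have t3 : t + (t + t) = pi *+ 2 by rewrite /t; field.
have q_cube : q3 R ^+ 3 = 1.
  rewrite /q3 -/t !exprS expr0 mulr1 -!expi_add t3 /expi cos2pi sin2pi.
  by [].
have q_neq1 : q3 R - 1 != 0.
  rewrite subr_eq0; apply/eqP => /(congr1 (@complex.Im R)) /= sin_t.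
  have : 0 < sin t.
    apply: sin_gt0_pi; rewrite /t; have := pi_gt0 R; lra.
  by rewrite sin_t ltxx.
apply: (mulfI q_neq1); apply/eqP; rewrite -subr_eq0; apply/eqP.
transitivity (q3 R ^+ 3 - 1); first by ring.
by rewrite q_cube subrr.
Qed.

End CubeRoot.

(** * The solvability criterion and the general solution *)

Theorem proposition4p3 (R : realType)
  (A : algType R[i]) (x y : A) (hA : quantum_plane (q3 R) x y)
  (L : unitAlgType R[i]) (iota : {lrmorphism A -> L})
  (hL : localization x y iota)
  (A1 : bimodType A) (xi eta : A1)
  (hA1 : quantum_plane_forms (q3 R) x y xi eta)
  (d : A -> A1) (hd : derivation d) (hdx : d x = xi) (hdy : d y = eta)
  (A1A1 : bimodType A) (tens : A1 -> A1 -> A1A1) (hT : tensor_product tens)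
  (sigma : A1A1 -> A1A1) (hsigma : braiding (q3 R) tens xi eta sigma)
  (nablaL : A1 -> A1A1) (hnablaL : left_connection tens d nablaL)
  (G : 'I_2 -> 'I_2 -> 'I_2 -> A) (hG : christoffel tens xi eta nablaL G) :
  ((exists nablaR : A1 -> A1A1,
      right_connection tens d nablaR /\ sigma_compatible sigma nablaL nablaR)
   <-> solvability_conditions (q3 R) iota x y G)
  /\
  (solvability_conditions (q3 R) iota x y G ->
   exists Gt : 'I_2 -> 'I_2 -> 'I_2 -> A,
     [/\ solution_symbols (q3 R) (iota x) (iota y)
           (fun i j k => iota (G i j k)) (fun i j k => iota (Gt i j k)),
         exists nablaR : A1 -> A1A1,
           right_connection tens d nablaR
           /\ christoffel tens xi eta nablaR Gt
       & forall nablaR : A1 -> A1A1, right_connection tens d nablaR ->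
           (sigma_compatible sigma nablaL nablaR
            <-> christoffel tens xi eta nablaR Gt)]).
Proof.
have q_rel := q3_rel R.
have three_neq0 : 3 != 0 :> R[i] by rewrite pnatr_eq0.
have bridge nablaR Gt : right_connection tens d nablaR ->
    christoffel tens xi eta nablaR Gt ->
    sigma_compatible sigma nablaL nablaR <-> cleared_symbols (q3 R) x y G Gt.
  move=> hR hGt.
  exact: (sigma_compatible_cleared q_rel three_neq0 hA hL hA1 hd hdx hdy hT hsigma
    hnablaL hR hG hGt).
(* Every family in [A] is the family of symbols of some right connection, so solvability amounts to
   finding symbols in [A]. *)
have realize Gt : exists nablaR : A1 -> A1A1,
    right_connection tens d nablaR /\ christoffel tens xi eta nablaR Gt.
  have [nablaR [hR n1 n2]] := right_connection_exists hA1 hd hT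
    (tform xi eta tens (Gt i1 i1 i1) (Gt i1 i1 i2) (Gt i1 i2 i1) (Gt i1 i2 i2))
    (tform xi eta tens (Gt i2 i1 i1) (Gt i2 i1 i2) (Gt i2 i2 i1) (Gt i2 i2 i2)).
  by exists nablaR; split=> //; apply/(christoffelE xi eta hT).
split; first split.
- move=> [nablaR [hR cpt]]; have [h hh] := christoffel_exists hA1 hT nablaR.
  exact: (cleared_symbols_solvable q_rel three_neq0 hA hL ((bridge _ _ hR hh).1 cpt)).
- move=> /(solvable_cleared_symbols q_rel hA hL)[Gt clr].
  have [nablaR [hR hGt]] := realize Gt.
  by exists nablaR; split=> //; apply/(bridge _ _ hR hGt).
move=> /(solvable_cleared_symbols q_rel hA hL)[Gt clr]; exists Gt; split.
- exact/(solution_symbols_cleared _ hL).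
- exact: realize.
move=> nablaR hR; split=> [cpt|hGt]; last exact/(bridge _ _ hR hGt).
have [h hh] := christoffel_exists hA1 hT nablaR.
have hE := cleared_symbols_uniq hL ((bridge _ _ hR hh).1 cpt) clr.
move/(christoffelE xi eta hT): hh; rewrite !hE => hh.
exact/(christoffelE xi eta hT).
Qed.
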